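(* Let $R$ be a complete regular local ring and let $A$ be an $R$-algebra. Then $A$ is parasolid if and only if $R$ is a direct summand of $A$ (as an $R$-module).
   Context: All rings are commutative with $1$. Let $R$ be a Noetherian local ring of dimension $d$ with maximal ideal $\mathfrak{m}$. Elements $x_1,\ldots,x_d\in R$ are called parameters if $V(x_1,\ldots,x_d)=V(\mathfrak{m})$; they define, via Čech cohomology, a class $1/(x_1\cdots x_d)\in H^d_{\mathfrak m}(R)$, called a paraclass. For an $R$-algebra $A$, $H^d_{\mathfrak m}(A)$ is the local cohomology of $A$ as an $R$-module. $A$ is called parasolid if every paraclass $0\neq c\in H^d_{\mathfrak m}(R)$ has non-zero image in $H^d_{\mathfrak m}(A)$. ''$R$ is a direct summand of $A$'' means that the structure map $R\to A$ has an $R$-linear left inverse. *)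

(* Defs.v *)
From HB Require Import structures.
From mathcomp Require Import all_boot all_order all_algebra.
From mathcomp Require Import ring boolp.

Set Implicit Arguments.
Unset Strict Implicit.
Unset Printing Implicit Defensive.

Import GRing.Theory.
Local Open Scope ring_scope.
Local Open Scope quotient_scope.

(* [idealr R] and [prime_idealr R] are the library's types of proper,
   respectively prime, ideals.  Together with [boolp] the boolean membership is
   no restriction: every [R -> Prop] satisfying the closure conditions can be
   turned into such an ideal. *)

Section LocalRings.
Variable R : comNzRingType.

Definition generated_by (I : {pred R}) (n : nat) (x : 'I_n -> R) : Prop :=
  forall r, r \in I <-> exists a : 'I_n -> R, r = \sum_(i < n) a i * x i.

(* Only proper ideals are quantified over: the unit ideal is generated by 1. *)
Definition noetherian : Prop :=
  forall I : idealr R, exists (n : nat) (x : 'I_n -> R),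
    generated_by (I : {pred R}) x.

Definition maximal_ideal (m : idealr R) : Prop :=
  forall J : idealr R, {subset m <= J} -> (J : {pred R}) =i m.

Definition is_local (m : idealr R) : Prop :=
  maximal_ideal m /\
  forall J : idealr R, maximal_ideal J -> (J : {pred R}) =i m.

Definition prime_chain (n : nat) (P : 'I_n.+1 -> prime_idealr R) : Prop :=
  forall i j : 'I_n.+1, (i < j)%N ->
    {subset P i <= P j} /\ ~ {subset P j <= P i}.

Definition krull_dim (d : nat) : Prop :=
  (exists P : 'I_d.+1 -> prime_idealr R, prime_chain P) /\
  (forall (n : nat) (P : 'I_n.+1 -> prime_idealr R),
     prime_chain P -> (n <= d)%N).

Definition regular_local (m : idealr R) (d : nat) : Prop :=
  [/\ noetherian, is_local m, krull_dim d &
      exists x : 'I_d -> R, generated_by (m : {pred R}) x].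

Fixpoint ideal_pow (I : {pred R}) (n : nat) : R -> Prop :=
  if n is n'.+1 then
    fun r => exists (k : nat) (a b : 'I_k -> R),
      [/\ forall i, a i \in I, forall i, ideal_pow I n' (b i)
        & r = \sum_(i < k) a i * b i]
  else fun _ => True.

(* The canonical map from R to the inverse limit of the R / I^n is bijective:
   [u] ranges over the representatives of the elements of that limit. *)
Definition adically_complete (I : {pred R}) : Prop :=
  forall u : nat -> R, (forall n, ideal_pow I n (u n.+1 - u n)) ->
    exists! a : R, forall n, ideal_pow I n (a - u n).

(* V(x_1, ..., x_d) = V(m) *)
Definition parameters (m : idealr R) (d : nat) (x : 'I_d -> R) : Prop :=
  forall P : prime_idealr R, (forall i, x i \in P) <-> {subset m <= P}.

End LocalRings.

Section Localization.
Variables (R : comNzRingType) (M : lmodType R) (f : R).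
Implicit Types p q : M * nat.

(* The pair (u, i) stands for the fraction u / f^i. *)
Definition loc_eq p q : bool :=
  `[< exists k : nat, f ^+ k *: (f ^+ q.2 *: p.1 - f ^+ p.2 *: q.1) = 0 >].

Lemma loc_eqP p q :
  reflect (exists k, f ^+ (k + q.2) *: p.1 = f ^+ (k + p.2) *: q.1)
          (loc_eq p q).
Proof.
apply: (iffP (asboolP _)) => -[k e]; exists k.
  by move/eqP: e; rewrite scalerBr !scalerA -!exprD subr_eq0 => /eqP.
by apply/eqP; rewrite scalerBr !scalerA -!exprD subr_eq0 e.
Qed.

Lemma loc_eq_refl : reflexive loc_eq.
Proof. by move=> p; apply/loc_eqP; exists 0%N. Qed.

Lemma loc_eq_sym : symmetric loc_eq.
Proof. by move=> p q; apply/loc_eqP/loc_eqP => -[k e]; exists k. Qed.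

Lemma loc_eq_trans : transitive loc_eq.
Proof.
move=> q p r /loc_eqP[k e] /loc_eqP[l e']; apply/loc_eqP.
exists (k + l + q.2)%N.
have -> : (k + l + q.2 + r.2 = l + r.2 + (k + q.2))%N.
  by rewrite addnACA [(r.2 + _)%N]addnC addnA [(l + k)%N]addnC.
rewrite exprD -scalerA e scalerA -exprD.
have -> : (l + r.2 + (k + p.2) = k + p.2 + (l + r.2))%N by rewrite addnC.
rewrite exprD -scalerA e' scalerA -exprD; congr (f ^+ _ *: _).
by rewrite addnACA [(p.2 + _)%N]addnC addnA.
Qed.

Canonical loc_eq_equiv :=
  EquivRel loc_eq loc_eq_refl loc_eq_sym loc_eq_trans.

Definition localization := {eq_quot loc_eq}.
HB.instance Definition _ := Choice.on localization.
HB.instance Definition _ := EqQuotient.on localization.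

Definition frac (u : M) (i : nat) : localization := \pi_localization (u, i).

Lemma frac_eqP u i v j :
  frac u i = frac v j <-> exists k, f ^+ (k + j) *: u = f ^+ (k + i) *: v.
Proof.
rewrite /frac; split => [/eqP|e].
  by rewrite piE /= => /loc_eqP.
by apply/eqP; rewrite piE /=; apply/loc_eqP.
Qed.

Lemma fracW (P : localization -> Prop) : (forall u i, P (frac u i)) -> forall y, P y.
Proof. by move=> Pfrac; elim/quotW => -[u i]; apply: Pfrac. Qed.

Lemma frac_expand k u i : frac (f ^+ k *: u) (k + i) = frac u i.
Proof. by apply/frac_eqP; exists 0%N; rewrite scalerA -exprD addnC. Qed.

Lemma frac_repr (y : localization) : y = frac (repr y).1 (repr y).2.
Proof. by rewrite /frac -surjective_pairing reprK. Qed.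

Definition loc_add (y z : localization) : localization :=
  let: (u, i) := repr y in let: (v, j) := repr z in
  frac (f ^+ j *: u + f ^+ i *: v) (i + j).

Definition loc_scale (r : R) (y : localization) : localization :=
  let: (u, i) := repr y in frac (r *: u) i.

Lemma loc_addE u i v j :
  loc_add (frac u i) (frac v j) = frac (f ^+ j *: u + f ^+ i *: v) (i + j).
Proof.
rewrite /loc_add.
have := frac_repr (frac u i); have := frac_repr (frac v j).
case: (repr (frac u i)) => u' i'; case: (repr (frac v j)) => v' j' /=.
move=> /frac_eqP[l ev] /frac_eqP[k eu]; apply/frac_eqP; exists (k + l)%N.
rewrite !scalerDr !scalerA -!exprD; congr (_ + _).
- have -> : (k + l + (i + j) + j' = (l + j + j') + (k + i))%N by ring.
  rewrite exprD -scalerA -eu scalerA -exprD.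
  by congr (f ^+ _ *: _); ring.
- have -> : (k + l + (i + j) + i' = (k + i + i') + (l + j))%N by ring.
  rewrite exprD -scalerA -ev scalerA -exprD.
  by congr (f ^+ _ *: _); ring.
Qed.

Lemma loc_scaleE r u i : loc_scale r (frac u i) = frac (r *: u) i.
Proof.
rewrite /loc_scale; have := frac_repr (frac u i).
case: (repr (frac u i)) => u' i' /= /frac_eqP[k e].
apply/frac_eqP; exists k.
by rewrite !scalerA ![_ * r]mulrC -!scalerA e.
Qed.

Lemma loc_addA : associative loc_add.
Proof.
elim/fracW=> u i; elim/fracW=> v j; elim/fracW=> w k.
rewrite !loc_addE !scalerDr !scalerA -!exprD addrA addnA.
by congr (frac (_ + _ + _) _); congr (f ^+ _ *: _); ring.
Qed.

Lemma loc_addC : commutative loc_add.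
Proof.
by elim/fracW=> u i; elim/fracW=> v j; rewrite !loc_addE addrC addnC.
Qed.

Lemma loc_add0 : left_id (frac 0 0) loc_add.
Proof. by elim/fracW=> u i; rewrite loc_addE scaler0 add0r expr0 scale1r. Qed.

Lemma loc_addN : left_inverse (frac 0 0) (loc_scale (-1)) loc_add.
Proof.
elim/fracW=> u i; rewrite loc_scaleE loc_addE scaleN1r scalerN addNr.
by apply/frac_eqP; exists 0%N; rewrite !scaler0.
Qed.

HB.instance Definition _ := GRing.isZmodule.Build localization
  loc_addA loc_addC loc_add0 loc_addN.

Lemma loc_scaleA a b y : loc_scale a (loc_scale b y) = loc_scale (a * b) y.
Proof. by elim/fracW: y => u i; rewrite !loc_scaleE scalerA. Qed.

Lemma loc_scale1 : left_id 1 loc_scale.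
Proof. by elim/fracW=> u i; rewrite loc_scaleE scale1r. Qed.

Lemma loc_scaleDr : right_distributive loc_scale +%R.
Proof.
move=> r; elim/fracW=> u i; elim/fracW=> v j.
rewrite [frac u i + _]loc_addE !loc_scaleE [RHS]loc_addE scalerDr.
by rewrite !scalerA ![r * _]mulrC.
Qed.

Lemma loc_scaleDl y : {morph loc_scale^~ y : a b / a + b}.
Proof.
elim/fracW: y => u i a b; rewrite !loc_scaleE [RHS]loc_addE.
by rewrite -scalerDr -scalerDl frac_expand.
Qed.

HB.instance Definition _ := GRing.Zmodule_isLmodule.Build R localization
  loc_scaleA loc_scale1 loc_scaleDr loc_scaleDl.

Lemma frac_addE u i v j :
  frac u i + frac v j = frac (f ^+ j *: u + f ^+ i *: v) (i + j).
Proof. exact: loc_addE. Qed.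

Lemma frac_scaleE r u i : r *: frac u i = frac (r *: u) i.
Proof. exact: loc_scaleE. Qed.

End Localization.

Arguments localization {R} M f.
Arguments frac {R M f} u i.

(* The map M_f -> M_g for g = f * h, sending u / f^i to h^i u / g^i. *)
Section LocRestriction.
Variables (R : comNzRingType) (M : lmodType R) (f g h : R) (e : g = f * h).

Definition loc_res of g = f * h :=
  fun y : localization M f =>
    let: (u, i) := repr y in (frac (h ^+ i *: u) i : localization M g).

Lemma loc_resE u i : loc_res e (frac u i) = frac (h ^+ i *: u) i.
Proof.
rewrite /loc_res; have := frac_repr (frac u i : localization M f).
case: (repr _) => v j /= /frac_eqP[k E]; apply/frac_eqP; exists k.
rewrite !scalerA e !exprMn.
have -> : f ^+ (k + i) * h ^+ (k + i) * h ^+ j =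
          h ^+ (k + i + j) * f ^+ (k + i) by rewrite [in RHS]exprD; ring.
have -> : f ^+ (k + j) * h ^+ (k + j) * h ^+ i =
          h ^+ (k + i + j) * f ^+ (k + j) by rewrite addnAC [in RHS]exprD; ring.
by rewrite -!scalerA E.
Qed.

Lemma loc_res_linear : linear (loc_res e).
Proof.
move=> r; elim/fracW=> u i; elim/fracW=> v j.
rewrite frac_scaleE frac_addE !loc_resE frac_scaleE frac_addE.
congr (frac _ _); rewrite !scalerDr !scalerA !exprD e !exprMn.
by congr (_ *: _ + _ *: _); ring.
Qed.

HB.instance Definition _ :=
  GRing.isLinear.Build R (localization M f) (localization M g) *:%R
    (loc_res e) loc_res_linear.

End LocRestriction.

Section LocMap.
Variables (R : comNzRingType) (M N : lmodType R) (F : {linear M -> N}) (f : R).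

(* u / f^i is sent to F(u) / f^i *)
Definition loc_map (y : localization M f) : localization N f :=
  let: (u, i) := repr y in frac (F u) i.

Lemma loc_mapE u i : loc_map (frac u i) = frac (F u) i.
Proof.
rewrite /loc_map; have := frac_repr (frac u i : localization M f).
case: (repr _) => v j /= /frac_eqP[k E]; apply/frac_eqP; exists k.
by rewrite -!linearZ E.
Qed.

Lemma loc_map_linear : linear loc_map.
Proof.
move=> r; elim/fracW=> u i; elim/fracW=> v j.
rewrite frac_scaleE frac_addE !loc_mapE frac_scaleE frac_addE linearD.
have FZ a w : F (a *: w) = a *: F w by exact: linearZ_LR.
by rewrite !FZ.
Qed.

HB.instance Definition _ :=
  GRing.isLinear.Build R (localization M f) (localization N f) *:%R
    loc_map loc_map_linear.

End LocMap.

(* For parameters x = (x_1, ..., x_d), H^d_m(M) is the d-th cohomology of the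
   Cech complex of M on x.  Since that complex vanishes in degree d + 1, it is
   the cokernel of the last differential
     \prod_j M_{x_1 .. x_(j-1) x_(j+1) .. x_d} -> M_{x_1 .. x_d}. *)

Section TopCech.
Variables (R : comNzRingType) (d : nat) (x : 'I_d -> R).

Definition prod_all : R := \prod_(i < d) x i.
Definition prod_but (j : 'I_d) : R := \prod_(i < d | i != j) x i.

Lemma prod_allE j : prod_all = prod_but j * x j.
Proof. by rewrite /prod_all (bigD1 j) //= mulrC. Qed.

Section Coefficients.
Variable M : lmodType R.

Definition cech_diff (c : forall j, localization M (prod_but j)) :
    localization M prod_all :=
  \sum_(j < d) (-1) ^+ j *: loc_res (prod_allE j) (c j).

Definition cech_coboundary : {pred localization M prod_all} :=
  fun y => `[< exists c, y = cech_diff c >].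

Lemma cech_coboundary_closed : zmod_closed cech_coboundary.
Proof.
split=> [|y z /asboolP[c ->] /asboolP[c' ->]]; apply/asboolP.
  exists (fun=> 0); rewrite /cech_diff big1 // => j _.
  by rewrite linear0 scaler0.
exists (fun j => c j - c' j); rewrite /cech_diff -sumrB.
by apply: eq_bigr => j _; rewrite linearB scalerBr.
Qed.

HB.instance Definition _ := GRing.isZmodClosed.Build _ cech_coboundary
  cech_coboundary_closed.

Definition top_cech := Quotient.quot (cech_coboundary : zmodClosed _).
HB.instance Definition _ := GRing.Zmodule.on top_cech.
HB.instance Definition _ := EqQuotient.on top_cech.

Definition cech_class (y : localization M prod_all) : top_cech := \pi_top_cech y.

Lemma cech_class_eqP y z :
  cech_class y = cech_class z <-> exists c, y - z = cech_diff c.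
Proof.
rewrite /cech_class; split=> [/eqP|E].
  by rewrite -Quotient.idealrBE => /asboolP.
by apply/eqP; rewrite -Quotient.idealrBE; apply/asboolP.
Qed.

End Coefficients.

Definition cech_map (M N : lmodType R) (F : {linear M -> N})
    (c : top_cech M) : top_cech N :=
  cech_class (loc_map F (repr c)).

Lemma cech_mapE (M N : lmodType R) (F : {linear M -> N}) y :
  cech_map F (cech_class y) = cech_class (loc_map F y).
Proof.
have /cech_class_eqP[c E] : cech_class (repr (cech_class y)) = cech_class y.
  exact: reprK.
apply/cech_class_eqP; exists (fun j => loc_map F (c j)).
rewrite -linearB E /cech_diff linear_sum; apply: eq_bigr => j _.
rewrite linearZ; congr (_ *: _).
by elim/fracW: (c j) => u i; rewrite /= loc_mapE !loc_resE loc_mapE linearZ_LR.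
Qed.

(* 1 / (x_1 ... x_d) *)
Definition paraclass : top_cech R^o := cech_class (frac (1 : R^o) 1).

End TopCech.

(* An R-algebra is a ring morphism phi : R -> A; the zero ring is allowed. *)

Section RestrictionOfScalars.
Variables (R : comNzRingType) (A : comPzRingType) (phi : {rmorphism R -> A}).

Definition restr of {rmorphism R -> A} : Type := A.

HB.instance Definition _ := GRing.Zmodule.copy (restr phi) A.

Definition restr_scale (r : R) (a : restr phi) : restr phi := phi r * (a : A).

Fact restr_scaleA a b (v : restr phi) :
  restr_scale a (restr_scale b v) = restr_scale (a * b) v.
Proof. by rewrite /restr_scale rmorphM mulrA. Qed.

Fact restr_scale1 : left_id 1 restr_scale.
Proof. by move=> v; rewrite /restr_scale rmorph1 mul1r. Qed.

Fact restr_scaleDr : right_distributive restr_scale +%R.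
Proof. by move=> r u v; exact: (mulrDr (phi r)). Qed.

Fact restr_scaleDl v : {morph restr_scale^~ v : a b / a + b}.
Proof. by move=> a b; rewrite /restr_scale rmorphD; exact: mulrDl. Qed.

HB.instance Definition _ := GRing.Zmodule_isLmodule.Build R (restr phi)
  restr_scaleA restr_scale1 restr_scaleDr restr_scaleDl.

Definition struct_map (r : R^o) : restr phi := phi r.

Fact struct_map_linear : linear struct_map.
Proof. by move=> a u v; rewrite /struct_map rmorphD rmorphM. Qed.

HB.instance Definition _ :=
  GRing.isLinear.Build R R^o (restr phi) *:%R struct_map struct_map_linear.

(* [m] is the maximal ideal of [R] and [d] its dimension. *)
Definition parasolid (m : idealr R) (d : nat) : Prop :=
  forall x : 'I_d -> R, parameters m x ->
    paraclass x <> 0 -> cech_map struct_map (paraclass x) <> 0.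

Definition direct_summand : Prop :=
  exists s : {linear restr phi -> R^o}, forall r : R, s (phi r) = r.

End RestrictionOfScalars.

(* Main.v *)
Require Import Defs.
From mathcomp Require Import all_boot all_order all_algebra.
From HB Require Import structures.
From mathcomp Require Import ring boolp classical_sets.
(* [frac] of all_algebra would otherwise hide the one of [Defs]. *)
Import Defs.

Set Implicit Arguments.
Unset Strict Implicit.
Unset Printing Implicit Defensive.

Import GRing.Theory.
Local Open Scope classical_set_scope.
Local Open Scope ring_scope.
Local Open Scope quotient_scope.

(* Only the parasolid condition for a regular system of parameters x is used.
   Since 1/(x_1 ... x_d) spans the socle of H = H^d_m(R), which is essential,
   its survival in H^d_m(A) makes H -> H^d_m(A) injective.  A partial R-linear
   left inverse that is maximal for extension is defined everywhere: otherwise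
   some h outside its domain satisfies m h <= domain (every class is killed by
   powers of the x_i), and it extends to h because H is injective with respect
   to m -> R, i.e. the Koszul cohomology H^1(x; H) vanishes.  A left inverse
   sends the class of a/(x_1 ... x_d)^n to the class of some
   b_n/(x_1 ... x_d)^n; the b_n form a Cauchy sequence, and a |-> lim b_n
   is the required splitting of R -> A.

   All of this rests on monomial ideals in x behaving as in a polynomial ring,
   which follows from x_l being a nonzerodivisor modulo every subset of the
   other x_i.  That in turn holds because every subset of x generates a prime
   ideal, which is deduced from Krull's principal ideal theorem. *)

(** Allowing the empty set besides the members of [P] provides a union for the empty chain. If the
    empty set comes out maximal, every member of [P] is empty and [A0] serves. *)
Lemma Zorn_union (T : Type) (P : set (set T)) :
  P !=set0 ->
  (forall F : set (set T), F !=set0 -> F `<=` P -> total_on F subset ->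
    P (\bigcup_(X in F) X)) ->
  exists A, P A /\ forall B, P B -> A `<=` B -> B `<=` A.
Proof.
move=> [A0 PA0] Pchain; pose Q := fun A : set T => A = set0 \/ P A.
have [|A [QA Amax]] := @Zorn_bigcup T Q.
  move=> F FQ Ftot; pose F' := F `&` P.
  have [[X F'X]|F'0] := EM (F' !=set0); last first.
    left; rewrite -subset0 => x [X FX Xx].
    case: (FQ _ FX) => [X0|PX]; first by move: Xx; rewrite X0.
    by case: F'0; exists X.
  right; have -> : \bigcup_(X in F) X = \bigcup_(X in F') X.
    apply/seteqP; split=> x [Y FY Yx]; last by exists Y => //; case: FY.
    exists Y => //; split=> //.
    by case: (FQ _ FY) => // Y0; move: Yx; rewrite Y0.
  apply: Pchain; [by exists X | by move=> Y [] | ].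
  by move=> Y Z [FY _] [FZ _]; apply: Ftot.
have maxA B : P B -> A `<=` B -> B `<=` A.
  move=> PB AB; apply: contrapT => BA.
  by apply: (Amax B); [split | right].
case: QA => [A_0|PA]; last by exists A.
exists A0; split=> // B PB _ b Bb.
by move: (maxA B PB); rewrite A_0 => /(_ (fun _ => False_ind _) b Bb).
Qed.

(** * Socle elements and Krull's principal ideal theorem *)

Section SocleElement.
Variables (R : comNzRingType) (V : lmodType R) (W : set V).
Hypothesis W_scale : forall r v, W v -> W (r *: v).

(** For each [z] in turn, the element is multiplied by a power of [z] that is the last to keep it
    outside [W]. Serves for quotients of [R], for H^d_m(R), and for the domain of a partial
    retraction. *)
Lemma socle_element (s : seq R) (v : V) :
  ~ W v -> {in s, forall z, exists k, W (z ^+ k *: v)} ->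
  exists2 a, ~ W (a *: v) & {in s, forall z, W (z *: (a *: v))}.
Proof.
move=> Wv; elim: s => [|z s IHs] s_nil; first by exists 1; rewrite ?scale1r.
have [|a Wav sav] := IHs; first by move=> y ys; apply: s_nil; rewrite inE ys orbT.
have [|k Wk] := s_nil z; first by rewrite inE eqxx.
have {}Wk : W (z ^+ k *: (a *: v)).
  by rewrite scalerA mulrC -scalerA; apply: W_scale.
have [j Wj Wj1] : exists2 j, ~ W (z ^+ j *: (a *: v)) &
                             W (z ^+ j.+1 *: (a *: v)).
  elim: k Wk => [|k IHk]; first by rewrite scale1r.
  by have [Wk _|Wk] := EM (W (z ^+ k *: (a *: v))); [apply: IHk | exists k].
exists (z ^+ j * a); first by rewrite -scalerA.
move=> y; rewrite inE => /orP[/eqP->|ys].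
  by rewrite -scalerA scalerA -exprS.
by rewrite scalerA mulrCA -!scalerA; apply/W_scale/sav.
Qed.

End SocleElement.

(** * Ideals and prime ideals as sets *)

Section Ideals.
Variable R : comNzRingType.
Implicit Types (I J K P Q : set R) (s : seq R).

Record ideal I : Prop := Ideal {
  ideal0 : I 0;
  idealD : forall a b, I a -> I b -> I (a + b);
  idealM : forall r a, I a -> I (r * a) }.

Lemma idealN I a : ideal I -> I a -> I (- a).
Proof. by move=> idI Ia; rewrite -mulN1r; apply: idealM. Qed.

Lemma idealB I a b : ideal I -> I a -> I b -> I (a - b).
Proof. by move=> idI Ia Ib; apply: idealD => //; apply: idealN. Qed.

Lemma ideal_subr I a b : ideal I -> I (a - b) -> I b -> I a.
Proof. by move=> idI Iab Ib; rewrite -(subrK b a); apply: idealD. Qed.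

Lemma ideal_mulr I r a : ideal I -> I a -> I (a * r).
Proof. by rewrite mulrC => *; apply: idealM. Qed.

Lemma ideal_sum I n (F : 'I_n -> R) (p : pred 'I_n) :
  ideal I -> (forall i, p i -> I (F i)) -> I (\sum_(i < n | p i) F i).
Proof. by move=> idI IF; apply: big_ind => //; [apply: ideal0 | apply: idealD]. Qed.

Lemma ideal_sub_setT I : ideal I -> I 1 -> setT `<=` I.
Proof. by move=> idI I1 r _; rewrite -(mulr1 r); apply: idealM. Qed.

Definition colon I x : set R := fun a => I (a * x).

Lemma colon_ideal I x : ideal I -> ideal (colon I x).
Proof.
rewrite /colon; split=> [|a b Ia Ib|r a Ia].
- by rewrite mul0r; apply: ideal0.
- by rewrite mulrDl; apply: idealD.
- by rewrite -mulrA; apply: idealM.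
Qed.

Definition adjoin I x : set R := fun r => exists a, I (r - a * x).

Lemma adjoin_ideal I x : ideal I -> ideal (adjoin I x).
Proof.
move=> idI; split=> [|r r' [a Ia] [a' Ia']|b r [a Ia]].
- by exists 0; rewrite mul0r subr0; apply: ideal0.
- exists (a + a'); have -> : r + r' - (a + a') * x = r - a * x + (r' - a' * x).
    by ring.
  exact: idealD.
- exists (b * a); rewrite -mulrA -mulrBr; exact: idealM.
Qed.

Lemma sub_adjoin I x : I `<=` adjoin I x.
Proof. by move=> r Ir; exists 0; rewrite mul0r subr0. Qed.

Lemma mem_adjoin I x : ideal I -> adjoin I x x.
Proof. by move=> idI; exists 1; rewrite mul1r subrr; apply: ideal0. Qed.

Lemma adjoin_sub I J x : ideal J -> I `<=` J -> J x -> adjoin I x `<=` J.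
Proof.
move=> idJ IJ Jx r [a /IJ]/ideal_subr; apply=> //; exact: idealM.
Qed.

Record prime_ideal P : Prop := PrimeIdeal {
  prime_ideal_ideal :> ideal P;
  prime_ideal1 : ~ P 1;
  prime_idealM : forall a b, P (a * b) -> P a \/ P b }.

Lemma prime_ideal_exp P a n : prime_ideal P -> P (a ^+ n) -> P a.
Proof.
move=> prP; elim: n => [/(prime_ideal1 prP)//|n IHn].
by rewrite exprS => /(prime_idealM prP)[].
Qed.

Lemma prime_ideal_notM P a b : prime_ideal P -> ~ P a -> ~ P b -> ~ P (a * b).
Proof. by move=> prP Pa Pb /(prime_idealM prP)[]. Qed.

Definition generates s I :=
  {in s, forall a, I a} /\
  forall J, ideal J -> {in s, forall a, J a} -> I `<=` J.

(** * Working locally at a prime [Q] without leaving [R] *)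

Section Saturation.
Variables (Q : set R).
Hypothesis prQ : prime_ideal Q.

(* The contraction to R of the extension of I to the localization R_Q. *)
Definition saturation I : set R := fun r => exists2 c, ~ Q c & I (c * r).
Definition saturated I := forall c r, ~ Q c -> I (c * r) -> I r.

Lemma saturation_ideal I : ideal I -> ideal (saturation I).
Proof.
move=> idI; split=> [|r r' [c Qc Ic] [c' Qc' Ic']|a r [c Qc Ic]].
- by exists 1; [apply: prime_ideal1 | rewrite mulr0; apply: ideal0].
- exists (c * c'); first exact: prime_ideal_notM.
  have -> : c * c' * (r + r') = c' * (c * r) + c * (c' * r') by ring.
  by apply: idealD => //; apply: idealM.
- by exists c => //; rewrite mulrCA; apply: idealM.
Qed.

Lemma sub_saturation I : I `<=` saturation I.
Proof. by move=> r Ir; exists 1; rewrite ?mul1r //; apply: prime_ideal1. Qed.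

Lemma saturation_saturated I : saturated (saturation I).
Proof.
move=> c r Qc [c' Qc' Ic]; exists (c' * c); first exact: prime_ideal_notM.
by rewrite -mulrA.
Qed.

Lemma saturation_mono I J : I `<=` J -> saturation I `<=` saturation J.
Proof. by move=> IJ r [c Qc /IJ]; exists c. Qed.

(** Nakayama's lemma over R_Q, by induction on the list of generators. The hypothesis puts [h] in K
    + Q(s) locally at [Q], tested on every ideal [J] containing this sum. *)
Lemma nakayama K s : ideal K ->
  (forall h, h \in s -> forall J, ideal J -> K `<=` J ->
     (forall q g, Q q -> g \in s -> J (q * g)) -> saturation J h) ->
  {in s, forall h, saturation K h}.
Proof.
have idQ : ideal Q by case: prQ.
elim: s K => [//|g s IHs] K idK sK.
(* This is K + Qg; the tail of the list is treated modulo it. *)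
pose K' : set R := fun r => exists2 q, Q q & K (r - q * g).
have idK' : ideal K'.
  split=> [|r r' [q Qq Kq] [q' Qq' Kq']|a r [q Qq Kq]].
  - by exists 0; [apply: ideal0 | rewrite mul0r subr0; apply: ideal0].
  - exists (q + q'); first exact: idealD.
    have -> : r + r' - (q + q') * g = r - q * g + (r' - q' * g) by ring.
    exact: idealD.
  - exists (a * q); first exact: idealM.
    by rewrite -mulrA -mulrBr; apply: idealM.
have KK' : K `<=` K'.
  by move=> r Kr; exists 0; [apply: ideal0 | rewrite mul0r subr0].
have K'g q : Q q -> K' (q * g).
  by move=> Qq; exists q => //; rewrite subrr; apply: ideal0.
have sK' : {in s, forall h, saturation K' h}.
  apply: (IHs _ idK') => h hs J idJ K'J Js; apply: (sK) => //.
  - by rewrite inE hs orbT.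
  - exact: subset_trans K'J.
  - by move=> q g' Qq; rewrite inE => /orP[/eqP->|]; [exact/K'J/K'g | apply: Js].
have K'sat : saturation K' g.
  have satK' := saturation_ideal idK'.
  have [|||c Qc] := sK g _ _ satK' _ _; first by rewrite inE eqxx.
  - by move=> r /KK' /sub_saturation.
  - move=> q g' Qq; rewrite inE => /orP[/eqP->|g's].
      exact/sub_saturation/K'g.
    by apply: idealM => //; apply: sK'.
  - exact: saturation_saturated.
(* Modulo [K] one has c g = q g, and c - q stays outside [Q]. *)
have Kg : saturation K g.
  case: K'sat => c Qc [q Qq Kq]; exists (c - q); last by rewrite mulrBl.
  by move=> Qcq; apply: Qc; apply: ideal_subr Qcq Qq.
have K'K : K' `<=` saturation K.
  move=> r [q Qq Kq]; apply: ideal_subr (saturation_ideal idK) (sub_saturation Kq) _.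
  exact: idealM (saturation_ideal idK) _ _ _.
move=> h; rewrite inE => /orP[/eqP->//|/sK'[c Qc /K'K]].
exact: saturation_saturated.
Qed.

(** Stands in for the finite length of J/K after localization at [Q]: ideals of R_Q are seen through
    their contractions. *)
Definition dcc J K := forall L : nat -> set R,
  (forall n, [/\ ideal (L n), saturated (L n), K `<=` L n & L n `<=` J]) ->
  (forall n, L n.+1 `<=` L n) -> exists n, forall k, (n <= k)%N -> L n `<=` L k.

Lemma dcc_refl K : dcc K K.
Proof.
move=> L LP _; exists 0%N => k _ r.
by case: (LP 0%N) => _ _ _ /[apply]; case: (LP k) => _ _ + _; apply.
Qed.

(** Locally at [Q], adjoining [r] adds at most one simple factor on top of [M]. A chain either falls
    into [M], where [dccM] applies, or never does, and is then controlled by its traces on [M]. *)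
Lemma dcc_adjoin M K r : ideal M -> saturated M ->
  (forall q, Q q -> M (q * r)) -> dcc M K ->
  K `<=` M -> dcc (saturation (adjoin M r)) K.
Proof.
move=> idM satM Mr dccM KM L LP Ldec.
have Lmono n k : (n <= k)%N -> L k `<=` L n.
  by move/subnK <-; elim: (k - n)%N => [//|j IHj]; apply: subset_trans (Ldec _) IHj.
have [||n nP] := dccM (fun n => L n `&` M).
- move=> n; case: (LP n) => idL satL KL _; split.
  + split; first by split; apply: ideal0.
      by move=> a b [? ?] [? ?]; split; apply: idealD.
    by move=> a b [? ?]; split; apply: idealM.
  + by move=> c a Qc [/(satL _ _ Qc) ? /(satM _ _ Qc)].
  + by move=> a Ka; split; [apply: KL | apply: KM].
  + by move=> a [].
- by move=> n a [/Ldec].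
have [[n' LM]|LM] := EM (exists n, L n `<=` M).
  exists (maxn n n') => k; rewrite geq_max => /andP[nk _] a La.
  apply: (nP k nk a _).1; split; first exact: Lmono (leq_maxl n n') _ La.
  exact/LM/(Lmono _ _ (leq_maxr n n')).
exists n => k nk u Lu; have [idL satL _ LJ] := LP k.
(* Modulo [M], [l] equals [r] up to factors outside [Q]. Subtracting a multiple of [l] brings a
   multiple of [u] into [M], where the traces of [L n] and [L k] agree. *)
have [l Ll Ml] : exists2 l, L k l & ~ M l.
  apply: contrapT => noL; apply: LM; exists k => l Ll.
  by apply: contrapT => Ml; apply: noL; exists l.
have [c Qc [a Ma]] := LJ l Ll.
have [_ _ _ /(_ u Lu) [c' Qc' [a' Ma']]] := LP n.
have Qa : ~ Q a.
  move=> /Mr Mar; apply: Ml; apply: (satM c) => //.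
  exact: ideal_subr Ma Mar.
apply: (satL (a * c')); first exact: prime_ideal_notM.
have Llu : L k (a' * c * l) by apply: idealM.
apply: ideal_subr (Llu) => //; apply: (nP k nk _ _).1; split.
  have idLn : ideal (L n) by case: (LP n).
  apply: idealB => //; first by apply: idealM.
  by apply: (Lmono _ _ nk).
have -> : a * c' * u - a' * c * l = a * (c' * u - a' * r) - a' * (c * l - a * r).
  by ring.
by apply: idealB => //; apply: idealM.
Qed.

End Saturation.

(** * Noetherian induction and the principal ideal theorem *)

Section Noetherian.
Hypothesis noethR : forall I, ideal I -> exists s, generates s I.

(** The union of a chain is an ideal with finitely many generators; these already lie in one member,
    which is therefore the union. *)
Lemma noetherian_max (F : set (set R)) :
  F !=set0 -> (forall I, F I -> ideal I) ->
  exists I, F I /\ forall J, F J -> I `<=` J -> J `<=` I.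
Proof.
move=> F0 Fid; apply: Zorn_union => // G [X0 GX0] GF Gtot.
pose U := \bigcup_(X in G) X.
have idG X : G X -> ideal X by move=> /GF/Fid.
have idU : ideal U.
  split=> [|a b [X GX Xa] [Y GY Yb]|r a [X GX Xa]].
  - by exists X0 => //; apply: ideal0 (idG _ GX0).
  - have [XY|YX] := Gtot _ _ GX GY.
      by exists Y => //; apply: (idealD (idG _ GY)) => //; apply: XY.
    by exists X => //; apply: (idealD (idG _ GX)) => //; apply: YX.
  - by exists X => //; apply: idealM (idG _ GX) _ _ Xa.
have [s [sU Us]] := noethR idU.
have [X GX sX] : exists2 X, G X & {in s, forall a, X a}.
  elim: s sU {Us} => [|a s IHs] sU; first by exists X0.
  have [|X GX sX] := IHs; first by move=> b bs; apply: sU; rewrite inE bs orbT.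
  have [|Y GY Ya] := sU a; first by rewrite inE eqxx.
  have [XY|YX] := Gtot _ _ GX GY.
    by exists Y => // b; rewrite inE => /orP[/eqP->//|/sX/XY].
  by exists X => // b; rewrite inE => /orP[/eqP->|/sX//]; apply: YX.
suff UX : U = X by rewrite -/U UX; apply: GF.
apply/seteqP; split; first exact: Us (idG _ GX) sX.
by move=> a Xa; exists X.
Qed.

(** An ideal maximal among those containing [I] and missing [S] is prime: if [a] and [b] are
    outside, adjoining either one meets [S], and the product of the two elements found would lie in
    [P] if [a * b] did. *)
Lemma exists_prime_disjoint I (S : set R) :
  ideal I -> S 1 -> (forall a b, S a -> S b -> S (a * b)) ->
  (forall a, I a -> ~ S a) ->
  exists P, [/\ prime_ideal P, I `<=` P & forall a, P a -> ~ S a].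
Proof.
move=> idI S1 SM IS.
have [||P [[idP IP PS] Pmax]] := @noetherian_max
    (fun J => [/\ ideal J, I `<=` J & forall a, J a -> ~ S a]).
- by exists I; split.
- by move=> J [].
have meet x : ~ P x -> exists2 s, S s & adjoin P x s.
  move=> Px; apply: contrapT => noS; apply: Px.
  apply: (Pmax (adjoin P x)); [split | exact: sub_adjoin | exact: mem_adjoin].
  - exact: adjoin_ideal.
  - by apply: subset_trans IP _; apply: sub_adjoin.
  - by move=> a Pa Sa; apply: noS; exists a.
exists P; split=> //; split=> // [/PS//|a b Pab].
apply: contrapT => /not_orP[/meet[s Ss [u Pu]] /meet[s' Ss' [v Pv]]].
apply: (PS (s * s')); last exact: SM.
have -> : s * s' = s' * (s - u * a) + u * a * (s' - v * b) + u * v * (a * b).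
  by ring.
by apply: idealD => //; first apply: idealD => //; apply: idealM.
Qed.

(** R_Q/K is Artinian when [Q] is nilpotent modulo [K]. For [M] maximal among the ideals satisfying
    the chain condition over [K], a proper [M] would leave a socle element of R/M, and adjoining it
    would enlarge [M]. *)
Lemma dcc_setT Q K s : prime_ideal Q -> ideal K -> saturated Q K ->
  generates s Q -> {in s, forall z, exists k, K (z ^+ k)} -> dcc Q setT K.
Proof.
move=> prQ idK satK [_ Qs] s_nil.
have [||M [[idM satM KM dccM] Mmax]] := @noetherian_max
    (fun M => [/\ ideal M, saturated Q M, K `<=` M & dcc Q M K]).
- by exists K; split=> //; apply: dcc_refl.
- by move=> J [].
have [M1|M1] := EM (M 1).
  move=> L LP; apply: dccM => n; have [*] := LP n; split=> // r _.
  exact: ideal_sub_setT M1 _ _.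
have [||r0 Mr0 sr0] := @socle_element R R^o M (idealM idM) s 1.
- by [].
- by move=> z /s_nil[k Kz]; exists k; apply: KM; rewrite -(mulr1 (z ^+ k)) in Kz.
pose r := r0 * 1.
have Mr : ~ M r by exact: Mr0.
have Qr : Q `<=` colon M r.
  by apply: Qs; [apply: colon_ideal | move=> z /sr0].
case: Mr; apply: (Mmax (saturation Q (adjoin M r))).
- split; first exact/saturation_ideal/adjoin_ideal.
  + exact: saturation_saturated.
  + by move=> a /KM /(@sub_adjoin M r) /(sub_saturation prQ).
  + exact: dcc_adjoin.
- by move=> a /(@sub_adjoin M r) /(sub_saturation prQ).
- exact/(sub_saturation prQ)/mem_adjoin.
Qed.

(* Krull's principal ideal theorem, with the symbolic powers of P1 replaced by
   the saturations at P1 of the ideals P + (y^n). *)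
Lemma exists_prime_between P P1 P2 x :
  prime_ideal P -> prime_ideal P1 -> prime_ideal P2 ->
  P `<=` P1 -> ~ P1 `<=` P -> P1 `<=` P2 -> ~ P2 `<=` P1 -> P2 x ->
  exists Q, [/\ prime_ideal Q, P `<=` Q, ~ Q `<=` P, Q `<=` P2 & ~ P2 `<=` Q /\ Q x].
Proof.
move=> prP prP1 prP2 PP1 P1P P12 P21 P2x.
have [P1x|P1x] := EM (P1 x); first by exists P1.
have Px : ~ P x by move/PP1.
apply: contrapT => noQ.
(* Under the assumption to be refuted, [P2] is minimal over P + (x). *)
have P2min Q : prime_ideal Q -> P `<=` Q -> Q x -> Q `<=` P2 -> P2 `<=` Q.
  move=> prQ PQ Qx QP2; apply: contrapT => P2Q; apply: noQ; exists Q; split=> //.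
  by move=> QP; apply/Px/QP.
have [idP idP1 idP2] := And3 (prP : ideal P) (prP1 : ideal P1) (prP2 : ideal P2).
have [y P1y Py] : exists2 y, P1 y & ~ P y.
  apply: contrapT => noy; apply: P1P => y P1y.
  by apply: contrapT => Py; apply: noy; exists y.
pose K := saturation P2 (adjoin P x).
(* Otherwise some prime over P + (x) misses all products of a power of [z] with an element outside
   [P2]; it lies inside [P2], so by minimality it contains [z]. *)
have P2K z : P2 z -> exists k, K (z ^+ k).
  move=> P2z; apply: contrapT => noK.
  have [||||Q [prQ PQ QS]] := @exists_prime_disjoint (adjoin P x)
     (fun r => exists2 c, ~ P2 c & exists k, r = c * z ^+ k).
  - exact: adjoin_ideal.
  - by exists 1; [apply: prime_ideal1 | exists 0%N; rewrite mulr1].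
  - move=> _ _ [c P2c [k ->]] [c' P2c' [k' ->]]; exists (c * c').
      exact: prime_ideal_notM.
    by exists (k + k')%N; rewrite exprD; ring.
  - by move=> r Pr [c P2c [k rE]]; apply: noK; exists k; exists c; rewrite -?rE.
  have Qz : Q z.
    apply: P2min P2z => //.
    - by apply: subset_trans PQ; apply: sub_adjoin.
    - exact/PQ/mem_adjoin.
    - move=> r Qr; apply: contrapT => P2r; apply: (QS r Qr).
      by exists r => //; exists 0%N; rewrite mulr1.
  apply: (QS z Qz); exists 1; first exact: prime_ideal1.
  by exists 1%N; rewrite mul1r.
pose q n := saturation P1 (adjoin P (y ^+ n)).
have idq n : ideal (q n) by apply/saturation_ideal/adjoin_ideal.
have Pq n : P `<=` q n by move=> r /(@sub_adjoin P (y ^+ n)) /(sub_saturation prP1).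
have qdec n : q n.+1 `<=` q n.
  apply: saturation_mono => r [a Pa]; exists (a * y); by rewrite -mulrA -exprS.
(* These ideals descend and contain [K], so they become stationary: for some n, [q n] lies in q(n+1)
   + (x) locally at [P2]. *)
pose L n := saturation P2 (adjoin (q n) x).
have [s gens] := noethR idP2.
have [|||||n nP] := @dcc_setT P2 K s prP2 _ _ gens _ L.
- exact/saturation_ideal/adjoin_ideal.
- exact: saturation_saturated.
- by move=> z zs; apply: P2K; apply: gens.1.
- move=> n; split=> //; first exact/saturation_ideal/adjoin_ideal.
    exact: saturation_saturated.
  by apply: saturation_mono => r [a Pa]; exists a; apply: Pq.
- by move=> n; apply: saturation_mono => r [a qa]; exists a; apply: qdec.
have [t [tq qt]] := noethR (idq n).
(* If c h = a x modulo q(n+1), then a x is in [q n], hence so is [a], because [x] is outside [P1].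
   Thus h lies in q(n+1) + P2 q(n) locally at [P2], and Nakayama applies. *)
have qsat : q n `<=` saturation P2 (q n.+1).
  apply: (qt); first exact: saturation_ideal.
  apply: nakayama => // h ht J idJ qJ tJ.
  have Lh : L n h by apply/(sub_saturation prP2)/sub_adjoin/tq.
  have [c P2c [a qa]] := nP n.+1 (leqnSn n) h Lh.
  exists c => //; apply: ideal_subr (qJ _ qa) _ => //.
  suff : q n `<=` colon J x.
    apply; apply: (saturation_saturated prP1 P1x); rewrite mulrC.
    have -> : a * x = c * h - (c * h - a * x) by ring.
    by apply: (idealB (idq n)); [apply/(idealM (idq n))/tq | apply: qdec].
  apply: qt; first exact: colon_ideal.
  by move=> g gt; rewrite /colon mulrC; apply: tJ.
(* Modulo [P], c' c y^n is a multiple of y^(n+1). Cancelling y^n puts c' c in P + (y), which is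
   inside [P1], although neither factor is. *)
have [c P2c [c' P1c' [a Pa]]] : saturation P2 (q n.+1) (y ^+ n).
  by apply/qsat/(sub_saturation prP1)/mem_adjoin.
have : P ((c' * c - a * y) * y ^+ n) by rewrite mulrBl -!mulrA -exprS.
case/(prime_idealM prP) => [Pcy|/(prime_ideal_exp prP)//].
apply: (@prime_ideal_notM P1 c' c) => //; first by move=> /P12.
by apply: ideal_subr (PP1 _ Pcy) _ => //; apply: idealM.
Qed.

End Noetherian.
End Ideals.

(** * Chains of primes in a local ring *)

Section PrimeChains.
Variables (R : comNzRingType) (m : set R).
Implicit Types (I P : set R) (ys : seq R).
Hypothesis noethR : forall I : set R, ideal I -> exists s, generates s I.
Hypothesis m_prime : prime_ideal m.
Hypothesis m_max : forall I, ideal I -> ~ I 1 -> I `<=` m.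

(** The colon ideal of [I] by [h] contains [c], so it is not inside [m] and must contain 1. *)
Lemma local_absorb I c h : ideal I -> ~ m c -> I (c * h) -> I h.
Proof.
move=> idI mc Ich; apply: contrapT => Ih; apply: mc.
by apply: (m_max (colon_ideal h idI)); rewrite /colon ?mul1r.
Qed.

Lemma prime_sub_max P : prime_ideal P -> P `<=` m.
Proof. by move=> prP; apply: m_max (prime_ideal1 prP); case: prP. Qed.

(** The number [n] counts strict inclusions, and only the bottom prime is named, so that the primes
    above it can be exchanged. *)
Fixpoint chain_from n P : Prop :=
  prime_ideal P /\
  if n is n'.+1 then exists P', [/\ P `<=` P', ~ P' `<=` P & chain_from n' P']
  else True.

Lemma chain_from_prime n P : chain_from n P -> prime_ideal P.
Proof. by case: n => [|n] []. Qed.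

(** The primes are exchanged from the top down: once the prime two steps above [P] contains [x], the
    principal ideal theorem replaces the one in between by a prime containing [x]. At the top, [m]
    itself contains [x]. *)
Lemma chain_from_through n P x : chain_from n.+1 P -> m x ->
  exists P', [/\ chain_from n P', P `<=` P' & P' x].
Proof.
elim: n P => [|n IHn] P [prP [P1 [PP1 P1P cP1]]] mx.
  by exists m; split=> //; apply: prime_sub_max.
have {}cP1 : chain_from n.+1 P1 by [].
have [P2 [cP2 P12 P2x]] := IHn P1 cP1 mx.
have [P21|P21] := EM (P2 `<=` P1).
  by exists P1; split=> //; apply: P21.
have prP1 := chain_from_prime cP1; have prP2 := chain_from_prime cP2.
have [Q [prQ PQ QP QP2 [P2Q Qx]]] :=
  exists_prime_between noethR prP prP1 prP2 PP1 P1P P12 P21 P2x.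
by exists Q; split=> //; split=> //; exists P2.
Qed.

Lemma chain_from_through_seq n P ys : chain_from (size ys + n) P ->
  {in ys, forall y, m y} ->
  exists P', [/\ chain_from n P', P `<=` P' & {in ys, forall y, P' y}].
Proof.
elim: ys P => [|y ys IHys] P cP ysm; first by exists P; split.
have [|P1 [cP1 PP1 P1y]] := chain_from_through cP (x := y).
  by apply: ysm; rewrite inE eqxx.
have [|P2 [cP2 P12 P2ys]] := IHys P1 cP1.
  by move=> z zs; apply: ysm; rewrite inE zs orbT.
exists P2; split=> //; first exact: subset_trans P12.
by move=> z; rewrite inE => /orP[/eqP->|/P2ys//]; apply: P12.
Qed.

(** Expresses that [m] lies in I + (ys) without forming the sum. *)
Definition max_generated_over I ys := forall J, ideal J -> I `<=` J ->
  {in ys, forall y, J y} -> m `<=` J.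

(** Krull's height bound in R/I. A longer chain, made to pass through all of [ys], would keep a
    strict inclusion above a prime that contains I + (ys), hence [m]. *)
Lemma chain_from_length I ys n P : max_generated_over I ys ->
  {in ys, forall y, m y} -> I `<=` P -> chain_from n P -> (n <= size ys)%N.
Proof.
move=> mI ysm IP cP; rewrite leqNgt; apply/negP => lt_ys_n.
have := cP; rewrite -(subnKC lt_ys_n) addSnnS => cP'.
have [P' [/[dup] /chain_from_prime prP' [_ [P2 [PP2 P2P cP2]]] PP' P'ys]] :=
  chain_from_through_seq cP' ysm.
apply/P2P/(subset_trans (prime_sub_max (chain_from_prime cP2))).
by apply: mI => //; [case: prP' | apply: subset_trans PP'].
Qed.

(** The argument that a regular local ring is a domain, applied to R/I: when the bound on chain
    length is attained above [P], the ideal [I] equals [P]. By induction on [ys], P lies in I + (y)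
    for some y outside [P], and Nakayama removes y. *)
Lemma chain_from_sub I ys P : ideal I -> max_generated_over I ys ->
  {in ys, forall y, m y} -> I `<=` P -> chain_from (size ys) P -> P `<=` I.
Proof.
move Dn: (size ys) => n.
elim: n I ys P Dn => [|n IHn] I ys P Dn idI mI ysm IP cP.
  apply: (subset_trans (prime_sub_max (chain_from_prime cP))).
  by apply: mI => // y; rewrite (size0nil Dn).
have [y ys_y Py] : exists2 y, y \in ys & ~ P y.
  apply: contrapT => noy; have [prP [P' [PP' P'P cP']]] := cP.
  apply/P'P/(subset_trans (prime_sub_max (chain_from_prime cP'))).
  apply: mI => //; first by case: prP.
  by move=> y ys_y; apply: contrapT => Py; apply: noy; exists y.
have [P1 [cP1 PP1 P1y]] := chain_from_through cP (ysm y ys_y).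
have prP := chain_from_prime cP; have prP1 := chain_from_prime cP1.
have [idP idP1] := conj (prP : ideal P) (prP1 : ideal P1).
have P_Iy : P `<=` adjoin I y.
  apply: subset_trans (PP1) _; apply: (IHn _ (rem y ys)) => //.
  - by rewrite size_rem // Dn.
  - exact: adjoin_ideal.
  - move=> J idJ IyJ ysJ; apply: mI => //.
      by apply: subset_trans IyJ; apply: sub_adjoin.
    move=> z; rewrite (perm_mem (perm_to_rem ys_y)) in_cons => /orP[/eqP->|/ysJ//].
    exact/IyJ/mem_adjoin.
  - by move=> z /mem_rem/ysm.
  - by apply: adjoin_sub => //; apply: subset_trans PP1.
have [s [sP Ps]] := noethR idP.
apply: (Ps) => // h hs; suff [c mc] : saturation m I h by apply: local_absorb.
apply: (nakayama m_prime idI) hs => g gs J idJ IJ sJ; apply: (sub_saturation m_prime).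
have [a Ia] := P_Iy g (sP g gs).
(* Writing g = a y modulo [I] forces [a] into [P], since y is outside [P]; hence P lies in I +
   mP. *)
have Pa : P a.
  have /(prime_idealM prP)[//|//] : P (a * y).
  by have := idealB idP (sP g gs) (IP _ Ia); rewrite subKr.
apply: ideal_subr (IJ _ Ia) _ => //.
suff : P `<=` colon J y by apply.
apply: Ps; first exact: colon_ideal.
by move=> z zs; rewrite /colon mulrC; apply: sJ (ysm y ys_y) zs.
Qed.

End PrimeChains.

(** * Monomial ideals *)

Section MonomialIdeals.
Variables (R : comNzRingType) (d : nat) (x : 'I_d -> R).
Implicit Types (T : {set 'I_d}) (e f : 'I_d -> nat).

Definition power_ideal T e : set R :=
  fun r => exists a : 'I_d -> R, r = \sum_(i in T) a i * x i ^+ e i.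

Lemma power_ideal_ideal T e : ideal (power_ideal T e).
Proof.
split=> [|_ _ [a ->] [b ->]|r _ [a ->]].
- by exists (fun=> 0); rewrite big1 // => i _; rewrite mul0r.
- exists (fun i => a i + b i); rewrite -big_split; apply: eq_bigr => i _.
  by rewrite mulrDl.
- by exists (fun i => r * a i); rewrite mulr_sumr; apply: eq_bigr => i _; rewrite mulrA.
Qed.
Hint Resolve power_ideal_ideal : core.

Lemma mem_power_ideal T e i : i \in T -> power_ideal T e (x i ^+ e i).
Proof.
move=> iT; exists (fun j => (j == i)%:R); rewrite (bigD1 i) //= eqxx mul1r.
by rewrite big1 ?addr0 // => j /andP[_ /negPf->]; rewrite mul0r.
Qed.

Lemma power_ideal_sub T e I : ideal I -> (forall i, i \in T -> I (x i ^+ e i)) ->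
  power_ideal T e `<=` I.
Proof.
by move=> idI Ix _ [a ->]; apply: ideal_sum => // i iT; apply/(idealM idI)/Ix.
Qed.

Lemma power_ideal_mono T e f : (forall i, i \in T -> (f i <= e i)%N) ->
  power_ideal T e `<=` power_ideal T f.
Proof.
move=> fe; apply: power_ideal_sub => // i iT.
by rewrite -(subnK (fe i iT)) exprD; apply: idealM => //; apply: mem_power_ideal.
Qed.

Lemma power_ideal_split T e i r : i \in T -> power_ideal T e r ->
  exists a, power_ideal (T :\ i) e (r - a * x i ^+ e i).
Proof.
move=> iT [a ->]; exists (a i); exists a.
rewrite (bigD1 i) //= [X in X - _]addrC addrK; apply: eq_bigl => j.
by rewrite !inE andbC.
Qed.

Lemma power_ideal_setD1 T e i : power_ideal (T :\ i) e `<=` power_ideal T e.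
Proof.
by apply: power_ideal_sub => // j; rewrite inE => /andP[_ jT]; apply: mem_power_ideal.
Qed.

Definition upd e i k : 'I_d -> nat := fun j => if j == i then k else e j.

Lemma upd_setD1 T e i k : power_ideal (T :\ i) (upd e i k) = power_ideal (T :\ i) e.
Proof.
have E j : j \in T :\ i -> upd e i k j = e j.
  by rewrite /upd !inE => /andP[/negPf->].
by apply/seteqP; split; apply: power_ideal_mono => j /E ->.
Qed.

Lemma power_ideal_exp0 T e i : i \in T -> e i = 0%N -> setT `<=` power_ideal T e.
Proof.
move=> iT ei; apply: ideal_sub_setT => //.
by have := mem_power_ideal e iT; rewrite ei expr0.
Qed.

Hypothesis nzd1 : forall T i u, i \notin T ->
  power_ideal T (fun=> 1%N) (x i * u) -> power_ideal T (fun=> 1%N) u.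

(** Induction on the sum of the exponents. A zero exponent gives the unit ideal and exponents all 1
    are the hypothesis [nzd1]; otherwise some exponent k + 2 is split into k + 1 and 1. *)
Lemma nzd_power_ideal T e l u : l \notin T ->
  power_ideal T e (x l * u) -> power_ideal T e u.
Proof.
have [n] := ubnP (\sum_(i in T) e i)%N.
elim: n T e l u => // n IHn T e l u; rewrite ltnS => len lT eu.
have [/existsP[i /andP[iT /eqP ei0]]|] := boolP [exists i, (i \in T) && (e i == 0%N)].
  by apply: power_ideal_exp0 iT ei0 _ _.
move=> /existsPn e_gt0.
have [/existsP[i /andP[iT ei]]|] := boolP [exists i, (i \in T) && (1 < e i)%N]; last first.
  move=> /existsPn e_le1.
  have e1 i : i \in T -> e i = 1%N.
    move=> iT; have := e_gt0 i; have := e_le1 i; rewrite iT /= -leqNgt -lt0n.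
    by case: (e i) => [|[]].
  have E : power_ideal T e = power_ideal T (fun=> 1%N).
    by apply/seteqP; split; apply: power_ideal_mono => i /e1->.
  by move: eu; rewrite E; apply: nzd1.
have lTi : l \notin T :\ i by rewrite inE (negPf lT) andbF.
have sumT k : (\sum_(j in T) upd e i k j = k + \sum_(j in T :\ i) e j)%N.
  rewrite (bigD1 i) //= /upd eqxx; congr addn.
  by apply: eq_big => [j|j /andP[_ /negPf->//]]; rewrite !inE andbC.
have sume : (\sum_(j in T) e j = e i + \sum_(j in T :\ i) e j)%N.
  by rewrite -sumT; apply: eq_bigr => j _; rewrite /upd; case: eqP => [->|].
case Dei: (e i) ei sume => [|[|k]] // _ sume; rename Dei into ei.
have IHe j v : (j <= k.+1)%N -> power_ideal T (upd e i j) (x l * v) ->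
    power_ideal T (upd e i j) v.
  move=> jk; apply: IHn => //; apply: leq_trans len; rewrite sumT sume.
  by rewrite ltn_add2r ltnS.
have IHi v : power_ideal (T :\ i) e (x i * v) -> power_ideal (T :\ i) e v.
  apply: IHn; last by rewrite !inE eqxx.
  by apply: leq_trans len; rewrite sume addSn ltnS leq_addl.
(* With I' generated by the other powers, induction at exponent k + 1 gives u = b x_i^(k+1) modulo
   I'. It remains to see that [b] is in I' + (x_i). *)
have [|b ub] := @power_ideal_split T (upd e i k.+1) i u iT.
  apply: IHe => //; apply: power_ideal_mono eu => j _; rewrite /upd.
  by case: eqP => // ->; rewrite ei.
rewrite upd_setD1 /upd eqxx in ub.
have [a ua] := power_ideal_split iT eu.
rewrite ei in ua.
(* Both expressions for x_l u agree modulo I', and x_i^(k+1) cancels there by induction. So x_l b is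
   in I' + (x_i), and induction at exponent 1 applies to [b]. *)
have ba : power_ideal (T :\ i) e (x l * b - a * x i).
  have IHik j v : power_ideal (T :\ i) e (x i ^+ j * v) -> power_ideal (T :\ i) e v.
    by elim: j => [|j IHj]; rewrite ?mul1r // exprS -mulrA => /IHi.
  apply: (IHik k.+1).
  have -> : x i ^+ k.+1 * (x l * b - a * x i) =
     (x l * u - a * x i ^+ k.+2) - x l * (u - b * x i ^+ k.+1).
    by rewrite (exprS _ k.+1); ring.
  by apply: idealB => //; apply: idealM.
have : power_ideal T (upd e i 1) b.
  apply: IHe => //.
  have: power_ideal T (upd e i 1) (x l * b - a * x i).
    by apply: (@power_ideal_setD1 T _ i); rewrite upd_setD1; apply: ba.
  move/ideal_subr; apply=> //; apply: idealM => //.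
  by have := mem_power_ideal (upd e i 1) iT; rewrite /upd eqxx expr1.
move=> /(power_ideal_split iT)[c]; rewrite upd_setD1 /upd eqxx expr1 => bc.
have -> : u = (u - b * x i ^+ k.+1) + x i ^+ k.+1 * (b - c * x i) + c * x i ^+ k.+2.
  by rewrite (exprS _ k.+1); ring.
apply: idealD => //; last first.
  by apply: idealM => //; rewrite -ei; apply: mem_power_ideal.
by apply: (@power_ideal_setD1 T _ i); apply: idealD => //; apply: idealM.
Qed.

(** Modulo the powers of the other variables, [x i] cancels from x_i (u - a x_i^k), where e_i = k +
    1. If e_i = 0, the predecessor is again 0 and the ideal is everything. *)
Lemma power_ideal_colon_var T e i u : i \in T ->
  power_ideal T e (x i * u) -> power_ideal T (upd e i (e i).-1) u.
Proof.
move=> iT eu; case Dei: (e i) => [|k] /=.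
  by apply: (@power_ideal_exp0 _ _ i) => //; rewrite /upd eqxx.
have [a] := power_ideal_split iT eu; rewrite Dei.
have -> : x i * u - a * x i ^+ k.+1 = x i * (u - a * x i ^+ k) by rewrite exprS; ring.
move=> /nzd_power_ideal; rewrite !inE eqxx => /(_ isT) ua.
apply: ideal_subr (power_ideal_setD1 (i := i) _) _ => //.
  by rewrite upd_setD1; apply: ua.
apply: idealM => //.
by have := mem_power_ideal (upd e i k) iT; rewrite /upd eqxx.
Qed.

Lemma power_ideal_colon_exp T e i k u : i \in T ->
  power_ideal T e (x i ^+ k * u) -> power_ideal T (upd e i (e i - k)) u.
Proof.
move=> iT; elim: k e => [|k IHk] e.
  rewrite mul1r; apply: power_ideal_mono => j _; rewrite /upd subn0.
  by case: eqP => // ->.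
rewrite exprS -mulrA => /(power_ideal_colon_var iT)/IHk.
apply: power_ideal_mono => j _; rewrite /upd eqxx.
by case: eqP => // _; rewrite subnS -!subn1 subnAC.
Qed.

(** Division by a monomial as in a polynomial ring. Truncated subtraction is right: an exponent
    dropping to 0 makes the ideal the whole ring. *)
Lemma power_ideal_colon e f u :
  power_ideal [set: 'I_d] e ((\prod_i x i ^+ f i) * u) ->
  power_ideal [set: 'I_d] (fun i => (e i - f i)%N) u.
Proof.
(* The variables are divided out one at a time, along a list without repetition. *)
suff H s v : uniq s -> power_ideal [set: 'I_d] e ((\prod_(i <- s) x i ^+ f i) * v) ->
    power_ideal [set: 'I_d] (fun i => if i \in s then (e i - f i)%N else e i) v.
  move=> /H; rewrite index_enum_uniq => /(_ isT).
  by apply: power_ideal_mono => i _; rewrite mem_index_enum.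
elim: s v => [|i s IHs] v /=; first by rewrite big_nil mul1r.
move=> /andP[/negPf si us]; rewrite big_cons mulrAC mulrC => /IHs-/(_ us).
move=> /(power_ideal_colon_exp (finset.in_setT i)); apply: power_ideal_mono => j _.
by rewrite /upd inE; case: eqP => //= ->; rewrite si.
Qed.

Definition monomial f : R := \prod_i x i ^+ f i.

Lemma monomialD f g : monomial (fun i => f i + g i)%N = monomial f * monomial g.
Proof. by rewrite -big_split; apply: eq_bigr => i _; rewrite exprD. Qed.

Lemma eq_monomial f g : f =1 g -> monomial f = monomial g.
Proof. by move=> fg; apply: eq_bigr => i _; rewrite fg. Qed.

Lemma monomial_upd f i k : f i = 0%N -> monomial (upd f i k) = monomial f * x i ^+ k.
Proof.
move=> fi0; have -> : x i ^+ k = monomial (upd (fun=> 0%N) i k).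
  rewrite /monomial (bigD1 i) //= /upd eqxx big1 ?mulr1 // => j /negPf->.
  by rewrite expr0.
rewrite -monomialD; apply: eq_monomial => j; rewrite /upd.
by case: eqP => [->|_]; rewrite ?fi0 ?addn0.
Qed.

Lemma monomial_const k : monomial (fun=> k) = prod_all x ^+ k.
Proof. by rewrite /monomial prodrXl. Qed.

Lemma power_ideal_monomial f e i u :
  (e i <= f i)%N -> power_ideal [set: 'I_d] e (monomial f * u).
Proof.
move=> ef; rewrite /monomial (bigD1 i) //= -(subnK ef) exprD.
set y := x i ^+ e i; rewrite [_ * y]mulrC -!mulrA; apply: ideal_mulr => //.
by apply: mem_power_ideal; rewrite finset.in_setT.
Qed.

(** Induction on [j]: the factor [b] found so far, times its monomial, is killed by x_j^n, and the
    colon formula shows that [b] is a multiple of x_j^t up to terms that the monomial sends into the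
    ideal. *)
Lemma power_ideal_torsion t n (j : nat) a :
  (forall i : 'I_d, (i < j)%N -> power_ideal [set: 'I_d] (fun=> t + n)%N (x i ^+ n * a)) ->
  exists b, power_ideal [set: 'I_d] (fun=> t + n)%N
    (a - monomial (fun i => if (i < j)%N then t else 0%N) * b).
Proof.
pose f k (i : 'I_d) := if (i < k)%N then t else 0%N.
elim: j => [|j IHj] tors_a.
  exists a; rewrite /monomial big1 => [|i _]; last by rewrite expr0.
  by rewrite mul1r subrr; apply: ideal0.
have [|b ab] := IHj; first by move=> i /ltnW/tors_a.
rewrite -/(f j) in ab; rewrite -/(f j.+1).
have [ltjd|lejd] := ltnP j d; last first.
  exists b; suff -> : monomial (f j.+1) = monomial (f j) by [].
  by apply: eq_monomial => i; rewrite /f !(leq_trans (ltn_ord i)) // leqW.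
pose i0 := Ordinal ltjd.
have f0 : f j i0 = 0%N by rewrite /f ltnn.
have fS : f j.+1 =1 upd (f j) i0 t.
  move=> i; rewrite /f /upd ltnS leq_eqVlt -val_eqE /=.
  by case: (_ == _).
(* The exponents left by the colon are n below j, t at j, and t + n above j. *)
pose g i := (t + n - upd (f j) i0 n i)%N.
have : power_ideal [set: 'I_d] g b.
  apply: power_ideal_colon; rewrite -/(monomial _) monomial_upd //.
  rewrite mulrAC mulrC.
  have -> : x i0 ^+ n * (monomial (f j) * b) =
     x i0 ^+ n * a - x i0 ^+ n * (a - monomial (f j) * b) by ring.
  by apply: idealB => //; [apply: tors_a | apply: idealM].
move=> /(power_ideal_split (finset.in_setT i0))[c].
have -> : g i0 = t by rewrite /g /upd eqxx addnK.
move=> bc; exists c; rewrite (eq_monomial fS) monomial_upd //.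
have -> : a - monomial (f j) * x i0 ^+ t * c = a - monomial (f j) * b +
    (b - c * x i0 ^+ t) * monomial (f j) by ring.
apply: idealD => //.
suff : power_ideal (finset.setT :\ i0) g `<=`
    colon (power_ideal finset.setT (fun=> t + n)%N) (monomial (f j)) by apply.
apply: power_ideal_sub => [|i]; first exact: colon_ideal.
rewrite !inE andbT /colon => /negPf i_i0; rewrite /g /upd i_i0 /f.
case: ltnP => [lt_ij|_].
  rewrite mulrC -/(f j) -[_ * _]mulr1.
  have -> : x i ^+ (t + n - t) = monomial (upd (fun=> 0%N) i n).
    by rewrite monomial_upd // /monomial big1 ?mul1r ?addKn // => l _; rewrite expr0.
  rewrite -monomialD; apply: (power_ideal_monomial (i := i)).
  by rewrite /f lt_ij /upd eqxx.
rewrite subn0; apply: ideal_mulr => //.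
by apply: (mem_power_ideal (fun=> t + n)%N); rewrite finset.in_setT.
Qed.

End MonomialIdeals.

(** * Top local cohomology *)

Section TopCohomology.
Variables (R : comNzRingType) (d : nat) (x : 'I_d -> R).
Local Notation X := (prod_all x).
Local Notation "[ 't' k ]" := (power_ideal x [set: 'I_d] (fun=> k)) (format "[ 't'  k ]").

Section Modules.
Variable M : lmodType R.
Implicit Types (u v : M) (y z : localization M X).
Local Notation cobound y := (y \in @cech_coboundary R d x M).

Lemma fracD (f : R) u v i :
  frac (u + v) i = frac u i + frac v i :> localization M f.
Proof. by rewrite frac_addE -scalerDr frac_expand. Qed.

Lemma frac0 (f : R) i : frac 0 i = 0 :> localization M f.
Proof. by apply/frac_eqP; exists 0%N; rewrite !scaler0. Qed.

Lemma cech_coboundaryZ r y : cobound y -> cobound (r *: y).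
Proof.
move=> /asboolP[c ->]; apply/asboolP; exists (fun j => r *: c j).
rewrite /cech_diff scaler_sumr; apply: eq_bigr => j _.
by rewrite (linearZ_LR (loc_res _)) !scalerA mulrC.
Qed.

Lemma cech_coboundary_frac j u n : cobound (frac (x j ^+ n *: u) n).
Proof.
apply/asboolP.
(* The sign cancels the one that the differential puts on component [j]. *)
pose c k : localization M (prod_but x k) :=
  if k == j then (-1) ^+ k *: frac u n else 0.
exists c; rewrite /cech_diff (bigD1 j) //= big1 => [|k /negPf kj].
  rewrite addr0 /c eqxx linearZ /= scalerA -exprD -signr_odd addnn odd_double.
  by rewrite expr0 scale1r loc_resE.
by rewrite /c kj linear0 scaler0.
Qed.

Lemma cech_coboundaryZ_exp j n u : cobound (x j ^+ n *: (frac u n : localization M X)).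
Proof. by rewrite frac_scaleE cech_coboundary_frac. Qed.

End Modules.

Implicit Types (y z : localization R^o X).
Local Notation cobound y := (y \in @cech_coboundary R d x R^o).

Lemma frac_cech_coboundary (u : R^o) i : [t i] u -> cobound (frac u i).
Proof.
move=> [a ->]; apply: (big_ind (fun v : R^o => cobound (frac v i))).
- by rewrite frac0 rpred0.
- by move=> v w Cv Cw; rewrite fracD rpredD.
- move=> j _; rewrite mulrC; exact: (cech_coboundary_frac j (a j : R^o)).
Qed.

(** Makes multiplication by X^l a map from R/(x_i^k) to R/(x_i^(k+l)): these are the transition maps
    of the direct system with limit H^d_m(R). *)
Lemma power_ideal_shift k l u : [t k] u -> [t k + l]%N (X ^+ l * u).
Proof.
have idt n : ideal [t n] := power_ideal_ideal x [set: 'I_d] (fun=> n).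
move=> [a ->]; rewrite mulr_sumr; apply: ideal_sum => // i _.
rewrite mulrCA; apply: idealM => //.
rewrite -!monomial_const mulrC.
have -> : x i ^+ k = monomial x (upd (fun=> 0%N) i k).
  by rewrite monomial_upd // /monomial big1 ?mul1r // => j _; rewrite expr0.
rewrite -monomialD -[monomial _ _]mulr1.
by apply: (@power_ideal_monomial _ _ x _ _ i); rewrite /upd eqxx.
Qed.

Hypothesis nzd1 : forall (T : {set 'I_d}) i u, i \notin T ->
  power_ideal x T (fun=> 1%N) (x i * u) -> power_ideal x T (fun=> 1%N) u.

(** Injectivity of R/(x_i^n) -> H^d_m(R). A coboundary has some presentation with numerator in the
    power ideal; comparing presentations costs a power of X, which the colon formula removes. *)
Lemma cech_coboundary_fracP (u : R^o) i : reflect ([t i] u) (cobound (frac u i)).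
Proof.
apply: (iffP idP); last exact: frac_cech_coboundary.
have idt n : ideal [t n] := power_ideal_ideal x [set: 'I_d] (fun=> n).
pose D y := exists k, exists2 v : R^o, [t k] v & y = frac v k.
have CD y : cobound y -> D y.
  move=> /asboolP[c ->]; apply: (big_ind D).
  - by exists 0%N; exists 0; [exact: ideal0 (idt 0%N) | exact: (esym (frac0 _ _ _))].
  - move=> _ _ [k [v tv ->]] [l [w tw ->]]; exists (k + l)%N.
    rewrite frac_addE; exists (X ^+ l *: v + X ^+ k *: w) => //.
    by apply: (idealD (idt _)); [|rewrite addnC]; apply: power_ideal_shift.
  - move=> j _; elim/fracW: (c j) => w k; rewrite loc_resE frac_scaleE.
    exists k; eexists; last by [].
    apply: (idealM (idt k)); apply: (ideal_mulr _ (idt k)).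
    by apply: (mem_power_ideal x (fun=> k)); rewrite finset.in_setT.
move=> /CD[k [v tv /frac_eqP[l e]]].
have : [t i + (l + k)]%N (monomial x (fun=> l + k)%N * u).
  rewrite monomial_const [_ * u]e [(_ + i)%N]addnC exprD.
  have -> : (i + (l + k) = k + (i + l))%N by ring.
  by rewrite -exprD; apply: power_ideal_shift.
move=> /(power_ideal_colon nzd1); apply: power_ideal_mono => j _.
by rewrite addnK.
Qed.

Lemma cech_torsion (t n j : nat) (a : R^o) :
  (forall i : 'I_d, (i < j)%N ->
    cobound (x i ^+ n *: (frac a (t + n) : localization R^o X))) ->
  exists b : R^o, cobound (frac a (t + n) -
    frac (monomial x (fun i => if (i < j)%N then t else 0%N) *: b) (t + n)).
Proof.
move=> tors_a; have [|b ab] := power_ideal_torsion nzd1 (t := t) (n := n) (j := j) (a := a).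
  by move=> i /tors_a; rewrite frac_scaleE => /cech_coboundary_fracP.
exists b; rewrite -scaleN1r frac_scaleE -fracD scaleN1r.
by apply: frac_cech_coboundary.
Qed.

(** Coregularity of x on H^d_m(R): [x j] acts surjectively on the classes killed by the earlier
    variables. *)
Lemma cech_divisible (j : 'I_d) y :
  (forall i : 'I_d, (i < j)%N -> cobound (x i *: y)) ->
  exists2 z, cobound (x j *: z - y) & forall i : 'I_d, (i < j)%N -> cobound (x i *: z).
Proof.
elim/fracW: y => u t; rewrite -(frac_expand _ 1 u t) [(1 + t)%N]addnC; set a := X ^+ 1 *: u.
move=> tors_a.
have [|b ab] := @cech_torsion t 1 j a.
  by move=> i /tors_a; rewrite expr1.
pose f (i : 'I_d) := if (i < j)%N then t else 0%N.
(* This is f + 1 with the variable [x j] removed: raising the denominator by one power of X supplies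
   the factor [x j], and for i < j the exponent t + 1 makes [x i] kill the result. *)
pose g (i : 'I_d) := if i == j then 0%N else if (i < j)%N then t.+1 else 1%N.
exists (frac (monomial x g *: b) (1 + (t + 1))) => [|i ij].
  rewrite frac_scaleE scalerA mulrC -{1}(expr1 (x j)) -monomial_upd; last first.
    by rewrite /g eqxx.
  have -> : monomial x (upd g j 1) = X ^+ 1 * monomial x f.
    rewrite -monomial_const -monomialD; apply: eq_monomial => i.
    rewrite /upd /g /f; case: eqP => [->|_]; first by rewrite ltnn.
    by case: ifP.
  by rewrite -scalerA frac_expand -opprB rpredN.
rewrite frac_scaleE; apply: frac_cech_coboundary.
have -> : x i *: (monomial x g *: b) = (x i * monomial x g) * b :> R.
  by rewrite scalerA.
have -> : x i = monomial x (upd (fun=> 0%N) i 1).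
  by rewrite monomial_upd // /monomial big1 ?mul1r // => l _; rewrite expr0.
rewrite -monomialD; apply: (@power_ideal_monomial _ _ x _ _ i).
by rewrite /upd /g eqxx ij; case: eqP ij => [->|]; rewrite ?ltnn ?addn1.
Qed.

(* Vanishing of the first Koszul cohomology of x on H^d_m(R), i.e. injectivity
   of H^d_m(R) with respect to the inclusion of (x_1, ..., x_d) into R. *)
Lemma cech_koszul (z : 'I_d -> localization R^o X) :
  (forall i j, cobound (x i *: z j - x j *: z i)) ->
  exists b, forall i, cobound (x i *: b - z i).
Proof.
move=> zC; suff H (k : nat) : exists b, forall i : 'I_d, (i < k)%N -> cobound (x i *: b - z i).
  by have [b bz] := H d; exists b => i; apply: bz.
elim: k => [|k [b bz]]; first by exists 0.
have [ltkd|ledk] := ltnP k d; last first.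
  by exists b => i _; apply: bz; apply: leq_trans ledk.
pose j := Ordinal ltkd.
(* By the cocycle condition the defect at [j] is killed by the earlier variables; dividing it by
   [x j] within their annihilator leaves the earlier equations intact. *)
have [|c cj ci] := @cech_divisible j (z j - x j *: b).
  move=> i ij; have -> : x i *: (z j - x j *: b) =
      (x i *: z j - x j *: z i) - x j *: (x i *: b - z i).
    by rewrite !scalerBr !scalerA [x j * x i]mulrC opprB addrA subrK.
  apply: rpredB; first exact: zC.
  exact: cech_coboundaryZ (bz i ij).
exists (b + c) => i; rewrite ltnS leq_eqVlt => /orP[ij|ik].
  have -> : i = j by apply: val_inj; apply/eqP.
  by rewrite scalerDr addrAC addrC; move: cj; rewrite opprB addrA addrAC -addrA.
by rewrite scalerDr addrAC rpredD ?bz ?ci.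
Qed.

End TopCohomology.

(** * Regular local rings *)

Section LibraryIdeals.
Variable R : comNzRingType.

Lemma idealr_ideal (J : idealr R) : ideal (fun r => r \in J).
Proof.
split=> [|a b|r a]; [exact: rpred0 | exact: rpredD | exact: idealMr].
Qed.

Lemma prime_idealr_ideal (P : prime_idealr R) : prime_ideal (fun r => r \in P).
Proof.
split=> [||a b]; first exact: (idealr_ideal P); first by rewrite idealr1.
by rewrite prime_idealrM => /orP.
Qed.

Lemma ideal_idealr (I : set R) : ideal I -> ~ I 1 ->
  exists J : idealr R, forall r, (r \in J) <-> I r.
Proof.
move=> idI I1; pose p : R -> bool := fun r => `[< I r >].
have p_closed : idealr_closed p.
  split; [by apply/asboolP/(ideal0 idI) | by apply/negP => /asboolP |].
  move=> a u v /asboolP Iu /asboolP Iv; apply/asboolP.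
  by apply: idealD => //; apply: idealM.
pose J : idealr R := HB.pack p (isIdealr.Build R p p_closed).
by exists J => r; split=> [/asboolP|Ir] //; apply/asboolP.
Qed.

End LibraryIdeals.

Section RegularLocal.
Variables (R : comNzRingType) (m : idealr R) (d : nat).
Hypothesis R_regular : regular_local m d.
Let mset : set R := fun r => r \in m.

Lemma regular_noetherian (I : set R) : ideal I -> exists s, generates s I.
Proof.
have [noethR _ _ _] := R_regular; move=> idI.
have [I1|I1] := EM (I 1).
  exists [:: 1]; split=> [a|J idJ J1]; first by rewrite inE => /eqP->.
  by move=> r _; apply: ideal_sub_setT idJ _ _ _; [apply: J1; rewrite inE|].
have [J JI] := ideal_idealr idI I1.
have [n [x gen_x]] := noethR J; exists [seq x i | i : 'I_n]; split=> [a|K idK Kx r].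
  move=> /mapP[i _ ->]; apply/JI/gen_x; exists (fun j => (j == i)%:R).
  rewrite (bigD1 i) //= eqxx mul1r big1 ?addr0 // => j /negPf->.
  by rewrite mul0r.
move=> /JI/gen_x[a ->]; apply: ideal_sum => // i _; apply: idealM => //.
by apply: Kx; rewrite map_f // mem_enum.
Qed.

Lemma regular_local_max (I : set R) : ideal I -> ~ I 1 -> I `<=` mset.
Proof.
have [_ [_ m_uniq] _ _] := R_regular; move=> idI I1.
have [||M [[idM M1 IM] Mmax]] := noetherian_max regular_noetherian
    (F := fun J => [/\ ideal J, ~ J 1 & I `<=` J]).
- by exists I; split.
- by move=> J [].
have [J JM] := ideal_idealr idM M1.
have Jmax : maximal_ideal J.
  move=> J' JJ' r; apply/idP/idP => [J'r|/JJ'//]; apply/JM.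
  apply: (Mmax (fun s => s \in J')) J'r; last by move=> s /JM/JJ'.
  split; [exact: idealr_ideal | by rewrite idealr1 |].
  by move=> s /IM/JM/JJ'.
by move=> r /IM/JM; rewrite (m_uniq _ Jmax).
Qed.

(** With S = {1}, disjointness only means properness, so the prime found above [m] is [m] itself. *)
Lemma regular_max_prime : prime_ideal mset.
Proof.
have [||||P [prP mP _]] := exists_prime_disjoint regular_noetherian
    (I := mset) (S := fun r => r = 1).
- exact: idealr_ideal.
- by [].
- by move=> _ _ -> ->; rewrite mulr1.
- by move=> r mr r1; move: mr; rewrite /mset r1 idealr1.
suff -> : mset = P by [].
apply/seteqP; split=> //; apply: regular_local_max (prime_ideal1 prP).
by case: prP.
Qed.

Lemma krull_dim_chain_from : exists P : set R, chain_from d P.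
Proof.
have [_ _ [[P chainP] _] _] := R_regular.
(* The chain is read from its top: k strict inclusions start at P_(d-k). *)
suff H k : (k <= d)%N -> chain_from k (fun r => r \in P (inord (d - k))).
  by exists (fun r => r \in P (inord (d - d))); apply: H.
elim: k => [|k IHk] lekd; first by split=> //; apply: prime_idealr_ideal.
split; first exact: prime_idealr_ideal.
exists (fun r => r \in P (inord (d - k))).
have [|sub nsub] := chainP (inord (d - k.+1)) (inord (d - k)).
  by rewrite !inordK ?ltnS ?leq_subr // ltn_sub2l.
by split=> //; apply: IHk; apply: ltnW.
Qed.

Variable x : 'I_d -> R.
Hypothesis gen_x : generated_by (m : {pred R}) x.

Lemma generator_in_max i : x i \in m.
Proof.
apply/gen_x; exists (fun j => (j == i)%:R).
rewrite (bigD1 i) //= eqxx mul1r big1 ?addr0 // => j /negPf->.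
by rewrite mul0r.
Qed.

Lemma generators_parameters : parameters m x.
Proof.
move=> P; split=> [Px r /gen_x[a ->]|mP i]; last exact/mP/generator_in_max.
by apply: rpred_sum => i _; apply: idealMr.
Qed.

(** A chain of length [d] is made to pass through the x_i with i in [T]. As many inclusions remain
    as there are other generators, so [chain_from_sub] identifies the ideal with the prime reached.
    If it contained another [x l], too few generators would remain for that chain. *)
Lemma power_ideal1_prime (T : {set 'I_d}) :
  prime_ideal (power_ideal x T (fun=> 1%N)) /\
  forall l, l \notin T -> ~ power_ideal x T (fun=> 1%N) (x l).
Proof.
pose I := power_ideal x T (fun=> 1%N).
have idI : ideal I := power_ideal_ideal x T _.
have [P0 cP0] := krull_dim_chain_from.
pose ys := [seq x i | i <- enum T].
pose zs := [seq x i | i <- enum (~: T)].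
have mP := regular_max_prime; have noethR := regular_noetherian.
have ltm := regular_local_max.
have seq_m (s : seq 'I_d) : {in [seq x i | i <- s], forall y, mset y}.
  by move=> _ /mapP[i _ ->]; apply: generator_in_max.
have dE : d = (size ys + size zs)%N.
  by rewrite !size_map -!cardE cardsC card_ord.
rewrite dE in cP0.
have [P [cP _ Pys]] := chain_from_through_seq noethR mP ltm cP0 (seq_m _).
have prP := chain_from_prime cP; have idP : ideal P by case: prP.
have IP : I `<=` P.
  by apply: power_ideal_sub => // i iT; rewrite expr1; apply: Pys; rewrite map_f // mem_enum.
have genI J : ideal J -> I `<=` J -> (forall i, i \notin T -> J (x i)) -> mset `<=` J.
  move=> idJ IJ JT r /gen_x[a ->]; apply: ideal_sum => // i _; apply: idealM => //.
  have [iT|/JT//] := boolP (i \in T).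
  by apply: IJ; rewrite -(expr1 (x i)); apply: (mem_power_ideal x (fun=> 1%N)).
have PI : P `<=` I.
  apply: (chain_from_sub noethR mP ltm idI _ (seq_m _) IP cP) => J idJ IJ Jzs.
  apply: genI => // i iT; apply: Jzs; rewrite map_f // mem_enum.
  by rewrite finset.in_setC.
have IE : I = P by apply/seteqP; split.
rewrite -/I; split; first by rewrite IE.
move=> l lT Ixl; pose us := [seq x i | i <- enum (~: T :\ l)].
have : (size zs <= size us)%N.
  apply: (chain_from_length noethR mP ltm (I := I) _ (seq_m _) IP cP).
  move=> J idJ IJ Jus; apply: genI => // i iT.
  have [->|il] := eqVneq i l; first exact: IJ.
  by apply: Jus; rewrite map_f // mem_enum !inE il.
rewrite !size_map -!cardE [X in (X <= _)%N](cardsD1 l) finset.in_setC lT.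
by rewrite ltnn.
Qed.

Lemma regular_nzd1 (T : {set 'I_d}) i u : i \notin T ->
  power_ideal x T (fun=> 1%N) (x i * u) -> power_ideal x T (fun=> 1%N) u.
Proof.
by have [prT Tx] := power_ideal1_prime T; move=> iT /(prime_idealM prT)[/Tx|].
Qed.

Lemma regular_max_power_ideal r : r \in m -> power_ideal x [set: 'I_d] (fun=> 1%N) r.
Proof.
by move=> /gen_x[a ->]; exists a; apply: eq_big => [i|i _]; rewrite ?inE ?expr1.
Qed.

End RegularLocal.

Section IdealPowers.
Variables (R : comNzRingType) (m : idealr R).

Lemma ideal_pow_ideal n : ideal (ideal_pow (m : {pred R}) n).
Proof.
elim: n => [//|n IHn]; split=> [|_ _ [k [a [b [am bm ->]]]] [l [a' [b' [am' bm' ->]]]]|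
  r _ [k [a [b [am bm ->]]]]].
- by exists 0%N, (fun=> 0), (fun=> 0); split=> [[]|[]|] //; rewrite big_ord0.
- pose cat (f : 'I_k -> R) (g : 'I_l -> R) i :=
    match split i with inl j => f j | inr j => g j end.
  exists (k + l)%N, (cat a a'), (cat b b'); split.
  + by move=> i; rewrite /cat; case: (split i) => j; [apply: am | apply: am'].
  + by move=> i; rewrite /cat; case: (split i) => j; [apply: bm | apply: bm'].
  + rewrite big_split_ord /=; congr (_ + _); apply: eq_bigr => i _; rewrite /cat.
      by rewrite -[lshift l i]/(unsplit (inl i)) unsplitK.
    by rewrite -[rshift k i]/(unsplit (inr i)) unsplitK.
- exists k, a, (fun i => r * b i); split=> // [i|]; first by apply: (idealM IHn); apply: bm.
  by rewrite mulr_sumr; apply: eq_bigr => i _; rewrite mulrCA.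
Qed.

(** Turns congruences between numerators over X^n into congruences for the m-adic topology. *)
Lemma power_ideal_ideal_pow d (x : 'I_d -> R) n : (forall i, x i \in m) ->
  power_ideal x [set: 'I_d] (fun=> n) `<=` ideal_pow (m : {pred R}) n.
Proof.
move=> xm; apply: power_ideal_sub => [|i _]; first exact: ideal_pow_ideal.
elim: n => [//|n IHn]; exists 1%N, (fun=> x i), (fun=> x i ^+ n).
by split=> //; rewrite big_ord1 exprS.
Qed.

End IdealPowers.

Section TopCohomologyMaps.
Variables (R : comNzRingType) (d : nat) (x : 'I_d -> R).

Lemma cech_class_eq0 (M : lmodType R) (y : localization M (prod_all x)) :
  cech_class y = 0 <-> y \in @cech_coboundary R d x M.
Proof.
have -> : 0 = cech_class (0 : localization M (prod_all x)) by rewrite /cech_class !piE.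
rewrite cech_class_eqP subr0; split=> [yc|/asboolP//]; exact/asboolP.
Qed.

Lemma loc_map_coboundary (M N : lmodType R) (F : {linear M -> N})
    (y : localization M (prod_all x)) :
  y \in @cech_coboundary R d x M -> loc_map F y \in @cech_coboundary R d x N.
Proof.
move=> /cech_class_eq0 y0; apply/cech_class_eq0; rewrite -cech_mapE y0.
have -> : 0 = cech_class (0 : localization M (prod_all x)) by rewrite /cech_class !piE.
by rewrite cech_mapE linear0; apply/cech_class_eq0; apply: rpred0.
Qed.

End TopCohomologyMaps.

(** * Splitting *)

Section Splitting.
Variables (R : comNzRingType) (m : idealr R) (d : nat).
Hypothesis R_regular : regular_local m d.
Variable x : 'I_d -> R.
Hypothesis gen_x : generated_by (m : {pred R}) x.
Variables (A : comPzRingType) (phi : {rmorphism R -> A}).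

Local Notation X := (prod_all x).
Local Notation L := (localization R^o X).
Local Notation LA := (localization (restr phi) X).
Local Notation C := (@cech_coboundary R d x R^o).
Local Notation CA := (@cech_coboundary R d x (restr phi)).
Local Notation phiL := (@loc_map R R^o (restr phi) (struct_map phi) X).

Let nzd1 := @regular_nzd1 R m d R_regular x gen_x.

Lemma frac_socle_torsion (M : lmodType R) (y : localization M X) i :
  exists k, x i ^+ k *: y \in @cech_coboundary R d x M.
Proof. by elim/fracW: y => u k; exists k; apply: cech_coboundaryZ_exp. Qed.

(** Identifies the classes killed by all x_i^n with those of denominator X^n: torsion with respect
    to every variable makes the numerator over X^(t+n) a multiple of X^t. *)
Lemma cech_torsion_all n (y : L) : (forall i, x i ^+ n *: y \in C) ->
  exists b : R^o, y - frac b n \in C.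
Proof.
elim/fracW: y => u t; rewrite -(frac_expand _ n u t) [(n + t)%N]addnC => tors_u.
have [|b ub] := @cech_torsion _ _ _ nzd1 t n d (X ^+ n *: u).
  by move=> i _; apply: tors_u.
exists b; move: ub; have -> : monomial x (fun i => if (i < d)%N then t else 0%N) = X ^+ t.
  by rewrite -monomial_const; apply: eq_monomial => i; rewrite ltn_ord.
by rewrite frac_expand.
Qed.

Hypothesis phi_paraclass : phiL (frac (1 : R^o) 1) \notin CA.

Lemma local_cech_absorb (M : lmodType R) (W : set M) (r : R) (v : M) :
  W 0 -> (forall u w, W u -> W w -> W (u + w)) -> (forall a u, W u -> W (a *: u)) ->
  r \notin m -> W (r *: v) -> W v.
Proof.
move=> W0 WD WZ rm Wrv.
have idI : ideal (fun a => W (a *: v)).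
  split=> [|a b|a b]; [by rewrite scale0r | by rewrite scalerDl; apply: WD |].
  by rewrite -scalerA; apply: WZ.
rewrite -(scale1r v).
apply: (local_absorb (regular_local_max R_regular) (c := r) idI) => /=.
  exact/negP.
by rewrite mulr1.
Qed.

(** A nonzero class in the kernel has a nonzero multiple killed by every [x i], thus of the form
    b/X. Being nonzero it has [b] outside [m], so 1/X would be in the kernel too. *)
Lemma cech_map_struct_inj y : phiL y \in CA -> y \in C.
Proof.
move=> phi_y; apply: contrapT => Cy.
have [||a Cay say] := @socle_element R L (fun y => y \in C) _ [seq x i | i : 'I_d] y Cy.
- by move=> r v; apply: cech_coboundaryZ.
- by move=> _ /mapP[i _ ->]; apply: frac_socle_torsion.
have [|b yb] := @cech_torsion_all 1 (a *: y).
  by move=> i; rewrite expr1; apply: say; rewrite map_f // mem_enum.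
have bm : b \notin m.
  apply/negP => /(regular_max_power_ideal gen_x)/frac_cech_coboundary Cb.
  by apply: Cay; rewrite -(subrK (frac b 1) (a *: y)); apply: rpredD.
move/negP: phi_paraclass; apply.
apply: (@local_cech_absorb LA (fun y => y \in CA) b) => //; first exact: rpred0.
- by move=> u v; apply: rpredD.
- by move=> r v; apply: cech_coboundaryZ.
have -> : (b : R) *: phiL (frac (1 : R^o) 1) = a *: phiL y - phiL (a *: y - frac b 1).
  have -> : frac b 1 = (b : R) *: (frac (1 : R^o) 1) :> L.
    by rewrite frac_scaleE /GRing.scale /= mulr1.
  by rewrite (linearB phiL) !(linearZ_LR phiL) subKr.
apply: rpredB; first exact: cech_coboundaryZ.
exact: loc_map_coboundary.
Qed.

(* A partially defined R-linear left inverse H^d_m(A) -> H^d_m(R) of the map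
   induced by phi, seen as a graph on representatives. *)
Record partial_retraction (G : set (LA * L)) : Prop := PartialRetraction {
  retrD : forall p q, G p -> G q -> G (p.1 + q.1, p.2 + q.2);
  retrZ : forall r p, G p -> G (r *: p.1, r *: p.2);
  retr_fun : forall p, G p -> p.1 \in CA -> p.2 \in C;
  retr_struct : forall c y, c \in CA -> G (phiL y + c, y) }.

Lemma partial_retraction0 :
  partial_retraction (fun p => exists2 c, c \in CA & p.1 = phiL p.2 + c).
Proof.
split=> [p q [c Cc ->] [c' Cc' ->]|r p [c Cc ->]|p [c Cc ->]|c y Cc] /=.
- by exists (c + c'); [apply: rpredD | rewrite (linearD phiL) addrACA].
- by exists (r *: c); [apply: cech_coboundaryZ | rewrite (linearZ_LR phiL) scalerDr].
- by move=> Cp; apply: cech_map_struct_inj; rewrite -[phiL _](addrK c); apply: rpredB.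
- by exists c.
Qed.

Lemma exists_retraction : exists2 G, partial_retraction G & forall h, exists z, G (h, z).
Proof.
have [||G [GP Gmax]] := @Zorn_union _ partial_retraction.
- by eexists; apply: partial_retraction0.
- move=> F [G0 FG0] FP Ftot.
  split=> [p q [G FG Gp] [G' FG' Gq]|r p [G FG Gp]|p [G FG Gp]|c y Cc].
  + have [GG'|G'G] := Ftot _ _ FG FG'.
      by exists G' => //; apply: (retrD (FP _ FG')) => //; apply: GG'.
    by exists G => //; apply: (retrD (FP _ FG)) => //; apply: G'G.
  + by exists G => //; apply: (retrZ (FP _ FG)).
  + exact: retr_fun (FP _ FG) _ Gp.
  + by exists G0 => //; apply: (retr_struct (FP _ FG0)).
exists G => // h; apply: contrapT => domh.
pose W v := exists z, G (v, z).
have WD u v : W u -> W v -> W (u + v).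
  by move=> [y Gy] [z Gz]; exists (y + z); exact: (retrD GP Gy Gz).
have WZ r v : W v -> W (r *: v).
  by move=> [z Gz]; exists (r *: z); exact: (retrZ GP r Gz).
have WC c : c \in CA -> W c.
  move=> Cc; exists 0; rewrite -[c]add0r -{1}(linear0 phiL).
  exact: (retr_struct GP).
have [|a Wa sa] := @socle_element R LA W WZ [seq x i | i : 'I_d] h domh.
  by move=> _ /mapP[i _ ->]; have [k Ck] := frac_socle_torsion h i; exists k; apply: WC.
pose h' := a *: h.
have /choice[z Gz] : forall i, exists z, G (x i *: h', z).
  by move=> i; apply: sa; rewrite map_f // mem_enum.
have GN p q : G p -> G q -> G (p.1 - q.1, p.2 - q.2).
  move=> Gp Gq; have := retrD GP Gp (retrZ GP (-1) Gq).
  by rewrite /= !scaleN1r.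
(* Both x_i z_j and x_j z_i are values at x_i x_j h', so the z_i form a Koszul cocycle; [b] is the
   value to be given to [h']. *)
have [|b zb] := @cech_koszul _ _ _ nzd1 z.
  move=> i j; have := GN _ _ (retrZ GP (x i) (Gz j)) (retrZ GP (x j) (Gz i)).
  move=> /(retr_fun GP) /=; apply; rewrite !scalerA [x j * x i]mulrC subrr; exact: rpred0.
pose G' : set (LA * L) := fun p => exists r, G (p.1 - r *: h', p.2 - r *: b).
have G'P : partial_retraction G'.
  split=> [p q [r Gp] [s Gq]|s p [r Gp]|p [r Gp] Cp|c y Cc].
  - exists (r + s); rewrite /= !scalerDl !opprD [p.1 + _ + _]addrACA [p.2 + _ + _]addrACA.
    exact: (retrD GP Gp Gq).
  - by exists (s * r); rewrite /= -!scalerA -!scalerBr; exact: (retrZ GP s Gp).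
  (* Single-valuedness: r h' is in the domain of [G], so r is in [m], since otherwise [h'] would be
     in the domain. With r a combination of the x_i, the value of [G] at r h' is r b up to a
     coboundary. *)
  - have Wrh : W (r *: h').
      rewrite -(subKr p.1 (r *: h')); have [y Gy] := WC _ Cp.
      by exists (y - (p.2 - r *: b)); apply: (GN _ _ Gy Gp).
    have : r \in m.
      apply/negPn/negP => rm; apply: Wa.
      apply: (local_cech_absorb _ WD WZ rm Wrh).
      exact/WC/rpred0.
    move=> /gen_x[c rE].
    have Gr : G (r *: h', \sum_(i < d) c i *: z i).
      rewrite rE scaler_suml.
      have G0 : G (0, 0).
        by have := retrZ GP 0 Gp; rewrite /= !scale0r.
      pose K u v := G (u, v).
      apply: (big_ind2 K) => //.
        by move=> u1 v1 u2 v2 G1 G2; apply: (retrD GP G1 G2).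
      by move=> i _; rewrite -scalerA; exact: (retrZ GP (c i) (Gz i)).
    have := retr_fun GP (retrD GP Gp Gr); rewrite /= subrK => /(_ Cp) Cp2.
    have -> : p.2 = p.2 - r *: b + \sum_(i < d) c i *: z i +
        \sum_(i < d) c i *: (x i *: b - z i).
      rewrite -addrA -big_split /=.
      under eq_bigr do rewrite scalerBr addrC subrK scalerA.
      by rewrite -scaler_suml -rE subrK.
    apply: rpredD; first exact: Cp2.
    by apply: rpred_sum => i _; apply/cech_coboundaryZ/zb.
  - by exists 0; rewrite /= !scale0r !subr0; apply: (retr_struct GP).
apply: Wa; exists b; apply: (Gmax G') => //.
  by move=> p Gp; exists 0; rewrite !scale0r !subr0 -surjective_pairing.
exists 1; rewrite /= !scale1r !subrr.
have := retrZ GP 0 (retr_struct GP 0 (rpred0 CA)).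
by rewrite /= !scale0r.
Qed.

Hypothesis R_complete : adically_complete m.

Lemma exists_splitting : direct_summand phi.
Proof.
have [G GP Gtot] := exists_retraction.
have GN p q : G p -> G q -> G (p.1 - q.1, p.2 - q.2).
  move=> Gp Gq; have := retrD GP Gp (retrZ GP (-1) Gq).
  by rewrite /= !scaleN1r.
have G_uniq (v : LA) n (b b' : R^o) : G (v, frac b n) -> G (v, frac b' n) ->
    ideal_pow (m : {pred R}) n (b - b').
  move=> Gb Gb'; have := retr_fun GP (GN _ _ Gb Gb').
  rewrite /= subrr -[- frac b' n]scaleN1r frac_scaleE -fracD scaleN1r.
  move=> /(_ (rpred0 CA)) /(cech_coboundary_fracP nzd1).
  by move=> tb; apply: (power_ideal_ideal_pow (generator_in_max gen_x)) tb.
have /choice[b Gb] : forall p : restr phi * nat,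
    exists b : R^o, G (frac p.1 p.2, frac b p.2).
  move=> [a n] /=; have [z Gz] := Gtot (frac a n).
  (* As a/X^n is killed by every x_i^n, so is its value. *)
  have [|c zc] := @cech_torsion_all n z.
    move=> i; apply: (retr_fun GP (retrZ GP (x i ^+ n) Gz)) => /=.
    exact: cech_coboundaryZ_exp.
  pose e := z - frac c n.
  (* The pair (0, e) belongs to [G] as the case of phi(e) - phi(e), so the value may be changed by
     the coboundary [e]. *)
  exists c; have /= := GN _ _ Gz (retr_struct GP e (c := - phiL e) _).
  rewrite subrr subr0 subKr; apply.
  by rewrite rpredN; apply: loc_map_coboundary.
(* Since X a/X^(n+1) = a/X^n, the numerator at level n + 1 also serves at level n. *)
have b_step a n : ideal_pow (m : {pred R}) n (b (a, n.+1) - b (a, n)).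
  apply: G_uniq (Gb (a, n)) => /=.
  have := retrZ GP (X ^+ 1) (Gb (a, n.+1)).
  by rewrite /= !frac_scaleE -add1n !frac_expand.
have /choice[s sP] : forall a, exists s : R,
    forall n, ideal_pow (m : {pred R}) n (s - b (a, n)).
  by move=> a; have [s [sP _]] := R_complete (b_step a); exists s.
have s_uniq a r : (forall n, ideal_pow (m : {pred R}) n (r - b (a, n))) -> s a = r.
  have [t [_ t_uniq]] := R_complete (b_step a).
  by move=> rP; rewrite -(t_uniq _ rP) -(t_uniq _ (sP a)).
have s_linear : linear (s : restr phi -> R^o).
  move=> r a a'; apply: s_uniq => n.
  have idp := ideal_pow_ideal m n.
  suff : ideal_pow (m : {pred R}) n (r * s a + s a' - (b (r *: a + a', n) : R)) by [].
  have -> : r * s a + s a' - (b (r *: a + a', n) : R) =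
      r * (s a - (b (a, n) : R)) + (s a' - (b (a', n) : R)) +
      (r * (b (a, n) : R) + (b (a', n) : R) - (b (r *: a + a', n) : R)) by ring.
  apply: (idealD idp).
    by apply: (idealD idp) (sP a' n); apply: (idealM idp).
  apply: G_uniq (Gb (r *: a + a', n)) => /=.
  have := retrD GP (retrZ GP r (Gb (a, n))) (Gb (a', n)).
  by rewrite /= !frac_scaleE -!fracD.
pose s_lin : {linear restr phi -> R^o} :=
  HB.pack (s : restr phi -> R^o)
    (GRing.isLinear.Build R (restr phi) R^o *:%R s s_linear).
exists s_lin => r; apply: s_uniq => n; apply: G_uniq (Gb (phi r, n)) => /=.
have := retr_struct GP (frac (r : R^o) n) (rpred0 CA).
by rewrite addr0 loc_mapE.
Qed.

End Splitting.

Theorem theorem2p9 (R : comNzRingType) (m : idealr R) (d : nat)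
    (R_regular : regular_local m d) (R_complete : adically_complete m)
    (A : comPzRingType) (phi : {rmorphism R -> A}) :
  parasolid phi m d <-> direct_summand phi.
Proof.
split=> [phi_solid|[s sK] x _ x_n0].
  have [_ _ _ [x gen_x]] := R_regular.
  apply: (exists_splitting R_regular gen_x _ R_complete).
  have := phi_solid x (generators_parameters gen_x).
  rewrite cech_mapE => phi_x; apply/negP => /cech_class_eq0; apply: phi_x.
  (* The paraclass of the generators is nonzero, since otherwise 1 would lie in [m]. *)
  move=> /cech_class_eq0/(cech_coboundary_fracP (regular_nzd1 R_regular gen_x)).
  move=> [a E]; have /negP[] := negbT (idealr1 m); apply/gen_x; exists a.
  by rewrite E; apply: eq_big => [i|i _]; rewrite ?inE ?expr1.
(* Conversely, the map induced by [s] on cohomology sends the image of a paraclass back to it. *)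
rewrite cech_mapE => /cech_class_eq0/(loc_map_coboundary s).
rewrite !loc_mapE /struct_map sK => Cx; apply: x_n0.
exact/cech_class_eq0.
Qed.
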